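(* Consider the configuration model ${\rm CM}_n(\boldsymbol d)$ with deterministic degree sequences $\boldsymbol d=(d_i)_{i\in[n]}$, and let $D_n=d_{U_n}$ with $U_n$ uniform on $[n]=\{1,\dots,n\}$. Assume that, as $n\to\infty$: (a) $D_n$ converges in distribution to a random variable $D$ with $\mathbb P(D\ge 1)=1$; (b) $\mathbb E[D_n]\to\mathbb E[D]<\infty$; (d) $\max_{i\in[n]}d_i=o(n/\log n)$. Then, for all $\beta\ge 0$ and $B\in\mathbb R$, the thermodynamic limit of the annealed pressure exists: as $n\to\infty$, $$\psi_n^{\rm an,d}(\beta,B)\longrightarrow \varphi^{\rm an,d}(\beta,B),$$ where $$\varphi^{\rm an,d}(\beta,B)=\frac{\beta\,\mathbb E[D]}{2}+\sup_{(s_k)_{k\ge1}:\ s_k\in(0,1)\ \forall k}G((s_k)_{k\ge 1}).$$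
   Context: Configuration model: for each $n$, $\boldsymbol d=(d_i)_{i\in[n]}$ (allowed to depend on $n$) is a sequence of positive integers with even sum $\ell_n=\sum_{i\in[n]}d_i$ (if the sum is odd, $d_n$ is increased by 1). Attach $d_i$ half-edges to each vertex $i\in[n]$ and pair all $\ell_n$ half-edges uniformly at random; each pair forms an edge. The resulting random multigraph (self-loops and multiple edges allowed) with edge multiset $E_n$ is ${\rm CM}_n(\boldsymbol d)$. Ising model: for $\beta\ge0$, $B\in\mathbb R$, $$Z_n(\beta,B)=\sum_{\sigma\in\{-1,+1\}^n}\exp\Big\{\beta\sum_{(i,j)\in E_n}\sigma_i\sigma_j+B\sum_{i\in[n]}\sigma_i\Big\},$$ where edges are counted with multiplicity and a self-loop at $i$ contributes $\sigma_i\sigma_i=1$. The annealed pressure is $\psi_n^{\rm an,d}(\beta,B)=\frac1n\log\mathbb E[Z_n(\beta,B)]$, where $\mathbb E$ is the expectation over the uniform pairing (the degrees are fixed). Functional $G$: with $p_k=\mathbb P(D=k)$, $$G((s_k)_{k\ge1})=\sum_{k\ge1}p_kI(s_k)+B\Big(2\sum_{k\ge1}s_kp_k-1\Big)+\mathbb E[D]\,F_\beta\Big(\frac{\sum_{k\ge1}kp_ks_k}{\mathbb E[D]}\Big),$$ where $I(t)=-t\log t-(1-t)\log(1-t)$ for $t\in(0,1)$, $I(0)=I(1)=0$, $$F_\beta(t)=\int_0^{\min\{t,1-t\}}\log f_\beta(u)\,du,\qquad f_\beta(u)=\frac{e^{-2\beta}(1-2u)+\sqrt{1+(e^{-4\beta}-1)(1-2u)^2}}{2(1-u)}.$$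 *)

(* Defs.v *)
From HB Require Import structures.
From mathcomp Require Export all_boot all_order all_algebra.
From mathcomp Require Export all_classical all_reals all_analysis.
Export Order.TTheory GRing.Theory Num.Theory.
Export numFieldNormedType.Exports.

Set Implicit Arguments.
Unset Strict Implicit.
Unset Printing Implicit Defensive.

Local Open Scope ring_scope.

Section configuration_model.
Variables (n : nat) (d : 'I_n -> nat).

Definition half_edge : finType := {i : 'I_n & 'I_(d i)}.

Definition total_degree : nat := (\sum_(i < n) d i)%N.

Definition max_degree : nat := (\max_(i < n) d i)%N.

(* The edges of the multigraph are the two-element blocks e of the pairing;
   the endpoints of e are the vertices [tag h] of its two half-edges h, so
   that self-loops and multiple edges are kept with their multiplicity. *)
Definition pairings : {set {set {set half_edge}}} :=
  [set E : {set {set half_edge}} |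
    finset.partition E [set: half_edge]%SET & [forall e in E, #|e| == 2%N]]%SET.

Variable R : realType.

Definition CM_expectation (X : {set {set half_edge}} -> R) : R :=
  (\sum_(E in pairings) X E) / #|pairings|%:R.

Definition spin (b : bool) : R := if b then 1 else -1.

(* The product over the two half-edges h of e is sigma_i sigma_j when e joins
   i and j, and sigma_i sigma_i = 1 when e is a self-loop at i. *)
Definition partition_function (beta B : R) (E : {set {set half_edge}}) : R :=
  \sum_(sigma : {ffun 'I_n -> bool})
    expR (beta * (\sum_(e in E) \prod_(h in e) spin (sigma (tag h)))
          + B * \sum_(i < n) spin (sigma i)).

Definition annealed_pressure (beta B : R) : R :=
  ln (CM_expectation (partition_function beta B)) / n%:R.

(* D_n = d U with U uniform on the n vertices: its distribution function and
   its mean. *)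
Definition degree_cdf (x : R) : R :=
  #|[set i : 'I_n | (d i)%:R <= x]%SET|%:R / n%:R.

Definition degree_mean : R := total_degree%:R / n%:R.

End configuration_model.

Definition cvg_in_distribution (R : realType) (F : nat -> R -> R)
    (disp : measure_display) (T : measurableType disp) (P : probability T R)
    (X : {RV P >-> R}) : Prop :=
  forall x : R, {for x, continuous (cdf X)} ->
    ((F n x)%:E @[n --> \oo] --> cdf X x)%classic.

Section annealed_functional.
Variable R : realType.

(* [ln 0 = 0], so that the formula also gives I(0) = I(1) = 0. *)
Definition entropy (t : R) : R := - t * ln t - (1 - t) * ln (1 - t).

Definition f_fun (beta u : R) : R :=
  (expR (- 2 * beta) * (1 - 2 * u)
   + Num.sqrt (1 + (expR (- 4 * beta) - 1) * (1 - 2 * u) ^+ 2))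
  / (2 * (1 - u)).

Definition F_fun (beta t : R) : R :=
  \int[lebesgue_measure]_(u in `[0, Num.min t (1 - t)]%classic)
    ln (f_fun beta u).

Variables (disp : measure_display) (T : measurableType disp).
Variables (P : probability T R) (D : {RV P >-> R}) (beta B : R).

Definition expected_degree : R := fine 'E_P[D].

(* The three series converge when 'E_P[D] is finite and s takes values in
   [0, 1]. *)
Definition G_fun (s : nat -> R) : R :=
  \big[+%R/0]_(1 <= k <oo) (pmf D k%:R * entropy (s k))
  + B * (2 * (\big[+%R/0]_(1 <= k <oo) (s k * pmf D k%:R)) - 1)
  + expected_degree
    * F_fun beta ((\big[+%R/0]_(1 <= k <oo) (k%:R * pmf D k%:R * s k))
                  / expected_degree).

(* G is bounded on this set of sequences, so that the real-valued [sup] is the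
   supremum. *)
Definition annealed_limit : R :=
  beta * expected_degree / 2
  + sup [set G_fun s | s in
          [set s : nat -> R |
            forall k, (1 <= k)%N -> 0 < s k < 1]]%classic.

End annealed_functional.

(* Main.v *)
Require Import Defs.
From mathcomp Require Import ring lra measurable_realfun.
From mathcomp Require Import zify.

(* Given the spins, the number of plus half-edges is some [m], and averaging the
   edge interaction over the pairing gives a quantity [g] depending only on [m]
   and on the total degree [2k].  Pairing one half-edge at a time shows that the
   effect of flipping one spin, [g (m + 1) / g m] for [2k] half-edges, is the
   image of the same ratio for [2k - 2] half-edges under a Moebius map which
   contracts log-ratios uniformly and whose fixed point is [f_beta].  Hence
   [ln g] differs from [2k F_beta(m / 2k)] by a bounded amount.
   The function [F_beta] is convex.  Replacing it by a tangent line at [a]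
   decouples the spins, so that the annealed partition function is bounded below
   by an explicit product over the vertices for every [a], and bounded above by
   the sum of these products over the [2k + 1] points [a = m / 2k].  The degree
   averages so obtained converge uniformly in [a], by convergence of the degree
   law and of its mean.  The Gibbs variational principle identifies the supremum
   over [a] of the limit with the supremum of [G]. *)

Set Implicit Arguments.
Unset Strict Implicit.
Unset Printing Implicit Defensive.
Local Open Scope classical_set_scope.
Local Open Scope ring_scope.

(** * Perfect matchings with two-valued weights *)

Section matchings.
Import mathcomp.boot.fintype mathcomp.boot.finset.
Variables (R : comNzRingType) (H : finType).
Local Open Scope set_scope.

Definition perfect_matching (A : {set H}) (E : {set {set H}}) : bool :=
  finset.partition E A && [forall e in E, #|e| == 2%N].

Definition matching_sum (w : {set H} -> R) (A : {set H}) : R :=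
  (\sum_(E : {set {set H}} | perfect_matching A E) \prod_(e in E) w e)%R.

(** The block of [x] has exactly two elements. The boolean equivalence has the form that lets
    [big_pred1] collapse a sum over partners of [x]. *)
Lemma matching_partner (A : {set H}) (E : {set {set H}}) (x : H) :
  perfect_matching A E -> x \in A ->
  exists2 y, y \in (A :\ x)%SET & forall z, ([set x; z]%SET \in E) && (z \in (A :\ x)%SET) = (z == y).
Proof.
move=> /andP[pE /forall_inP E2] xA.
have cE := cover_partition pE.
have xc : x \in cover E by rewrite cE.
have be := pblock_mem xc; have := xc; rewrite -mem_pblock => xb.
have : #|(pblock E x :\ x)%SET| == 1%N.
  by have := E2 _ be; rewrite (cardsD1 x) xb add1n eqSS.
move=> /cards1P[y yE].
have ey : pblock E x = [set x; y]%SET by rewrite -(setD1K xb) yE.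
have yb : y \in pblock E x by rewrite ey !inE eqxx orbT.
have yx : y != x.
  have : y \in (pblock E x :\ x)%SET by rewrite yE inE.
  by rewrite !inE => /andP[].
exists y.
  by rewrite !inE yx /= -cE; apply/bigcupP; exists (pblock E x).
move=> z; apply/andP/eqP => [[zE] | ->].
  rewrite !inE => /andP[zx zA].
  have /(_ _ _ zE) := def_pblock (partition_trivIset pE).
  move=> /(_ x); rewrite !inE eqxx /= => /(_ isT) eb.
  have : z \in (pblock E x :\ x)%SET by rewrite !inE zx eb !inE eqxx orbT.
  by rewrite yE inE => /eqP.
rewrite -ey be !inE yx /= -cE; split=> //.
by apply/bigcupP; exists (pblock E x).
Qed.

Lemma perfect_matchingD1 (A : {set H}) (E : {set {set H}}) (x y : H) :
  perfect_matching A E -> [set x; y]%SET \in E ->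
  perfect_matching (A :\: [set x; y])%SET (E :\ [set x; y])%SET.
Proof.
move=> /andP[pE /forall_inP E2] xyE; apply/andP; split.
  exact: partitionD1.
by apply/forall_inP => e; rewrite !inE => /andP[_ /E2].
Qed.

(** Inverse of [perfect_matchingD1]; the second conclusion lets the new pair be split off a product
    over blocks. *)
Lemma perfect_matchingU1 (A : {set H}) (E : {set {set H}}) (x y : H) :
  x \in A -> y \in (A :\ x)%SET ->
  perfect_matching (A :\: [set x; y])%SET E ->
  perfect_matching A ([set x; y] |: E)%SET /\ [set x; y]%SET \notin E.
Proof.
move=> xA; rewrite !inE => /andP[yx yA] /andP[pE /forall_inP E2].
have xyA : [set x; y]%SET \subset A.
  by apply/subsetP => z; rewrite !inE => /orP[] /eqP ->.
have nE : [set x; y]%SET \notin E.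
  apply/negP => xyE; have := partitionS pE xyE => /subsetP/(_ x).
  by rewrite !inE eqxx /= => /(_ isT).
split=> //; apply/andP; split; last first.
  apply/forall_inP => e; rewrite !inE => /predU1P[->|/E2//].
  by rewrite cards2 (eq_sym x) yx.
have n0 : [set x; y]%SET != set0 :> {set H} by apply/set0Pn; exists x; rewrite !inE eqxx.
have eA : A = ([set x; y] :|: A :\: [set x; y])%SET.
  by rewrite setDE setUIr setUCr setIT; apply/esym/setUidPr.
rewrite [X in partition _ X]eA; apply: partitionU1 => //.
rewrite -setI_eq0; apply/eqP/setP => z; rewrite !inE.
by case: (_ || _); rewrite ?andbF.
Qed.

(** Conditioning on the partner of [x]: each matching has exactly one pair containing [x], and
    deleting it leaves a matching of the other points. *)
Lemma matching_sum_rec (w : {set H} -> R) (A : {set H}) (x : H) : x \in A ->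
  matching_sum w A =
  (\sum_(y in (A :\ x)%SET) w [set x; y]%SET * matching_sum w (A :\: [set x; y])%SET)%R.
Proof.
move=> xA.
transitivity (\sum_(E : {set {set H}} | perfect_matching A E)
   \sum_(y | ([set x; y]%SET \in E) && (y \in (A :\ x)%SET)) \prod_(e in E) w e)%R.
  apply: eq_bigr => E mE; have [y yA yP] := matching_partner mE xA.
  by rewrite (big_pred1 y).
rewrite (exchange_big_dep (mem (A :\ x)%SET)) /=; last by move=> E y _ /andP[].
apply: eq_bigr => y yA; rewrite /matching_sum mulr_sumr.
rewrite (reindex_onto (fun E => [set x; y] |: E)%SET (fun E => E :\ [set x; y])%SET) /=; last first.
  by move=> E /andP[_ /andP[xyE _]]; rewrite setD1K.
apply: eq_big => [E|E /andP[/andP[_ _] /eqP EE]].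
  apply/idP/idP => [/andP[/andP[mE _] /eqP EE]|mE].
    by rewrite -EE; apply: perfect_matchingD1; rewrite // !inE eqxx.
  have [-> nE] := perfect_matchingU1 xA yA mE.
  by rewrite setU1K // eqxx yA !inE eqxx.
have nE : [set x; y]%SET \notin E by rewrite -EE !inE eqxx.
by rewrite big_setU1.
Qed.

Lemma matching_sum0 (w : {set H} -> R) : matching_sum w set0%SET = 1%R.
Proof.
rewrite /matching_sum (big_pred1 set0%SET) ?big_set0 // => E.
rewrite /perfect_matching partition_set0 /=; case: eqP => [->|//].
by apply/forall_inP => e; rewrite inE.
Qed.

End matchings.

(** * Matching sums of points carrying spins *)

Section two_spin_matchings.
Import mathcomp.boot.fintype mathcomp.boot.finset.
Variables (R : comNzRingType) (x y : R).

(* Weighted number of perfect matchings of [m] plus and [p] minus points, with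
   weight [x] on equal and [y] on opposite pairs; meaningful when [m + p = 2k]. *)
Fixpoint spin_matching (k m p : nat) : R :=
  if k is k'.+1 then
    if m is m'.+1 then
      m'%:R * (x * spin_matching k' m'.-1 p) + p%:R * (y * spin_matching k' m' p.-1)
    else p.-1%:R * (x * spin_matching k' 0 p.-2)
  else 1.

Section finite_set.
Variables (H : finType) (w : {set H} -> R) (tau : H -> bool).
Hypothesis w_spin : forall h h', h != h' ->
  w [set h; h']%SET = if tau h == tau h' then x else y.

Definition spin_card (t : bool) (A : {set H}) := #|[set h in A | tau h == t]%SET|.

Lemma spin_cardD1 t (A : {set H}) h : h \in A ->
  spin_card t A = ((tau h == t) + spin_card t (A :\ h)%SET)%N.
Proof.
move=> hA; rewrite /spin_card (cardsD1 h) !inE hA /=; congr (_ + _)%N.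
by apply: eq_card => z; rewrite !inE andbA.
Qed.

Lemma spin_card_sum (A : {set H}) : (spin_card true A + spin_card false A = #|A|)%N.
Proof.
rewrite /spin_card -(cardsID [set h | tau h] A); congr (_ + _)%N.
  by apply: eq_card => z; rewrite !inE eqb_id.
by apply: eq_card => z; rewrite !inE eqbF_neg andbC.
Qed.

(** Induction on [k], expanding at a plus point when there is one and at any point otherwise, as the
    recursion of [spin_matching] does. *)
Lemma matching_sum_spin k (A : {set H}) : #|A| = k.*2 ->
  matching_sum w A = spin_matching k (spin_card true A) (spin_card false A).
Proof.
elim: k A => [|k IH] A cA.
  by move/eqP: cA; rewrite double0 cards_eq0 => /eqP->; rewrite matching_sum0.
have sumD (h : H) : h \in A -> matching_sum w A =
    \sum_(z in (A :\ h)%SET | tau z == tau h) x * matching_sum w (A :\ h :\ z)%SET +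
    \sum_(z in (A :\ h)%SET | tau z != tau h) y * matching_sum w (A :\ h :\ z)%SET.
  move=> hA; rewrite (matching_sum_rec w hA) (bigID (fun z => tau z == tau h)) /=.
  congr (_ + _); apply: eq_bigr => z /andP[]; rewrite !inE => /andP[zh zA] tz;
    by rewrite setDDl w_spin 1?[h == z]eq_sym // (eq_sym (tau h)) ?tz ?(negPf tz).
have cD (h z : H) : h \in A -> z \in (A :\ h)%SET -> #|(A :\ h :\ z)%SET| = k.*2.
  move=> hA zA; move: cA; rewrite (cardsD1 h) hA (cardsD1 z (A :\ h)%SET) zA.
  by rewrite doubleS !add1n => -[].
have [|p0] := posnP (spin_card true A).
  move=> t0; rewrite t0.
  have /card_gt0P[h hA] : (0 < #|A|)%N by rewrite cA doubleS.
  have nt z : z \in A -> tau z = false.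
    move=> zA; apply/negP => tz; move: t0.
    by rewrite (spin_cardD1 true zA) tz.
  rewrite (sumD h hA) [X in _ + X]big1 ?addr0; last first.
    by move=> z /andP[]; rewrite !inE => /andP[zh zA]; rewrite !nt // eqxx.
  have fA : spin_card false A = #|A| by rewrite -spin_card_sum t0.
  have ct (B : {set H}) : B \subset A -> spin_card true B = 0%N.
    move=> BA; apply: eq_card0 => z; rewrite !inE.
    by apply/negP => /andP[zB]; rewrite nt //; apply: (subsetP BA).
  rewrite (eq_bigr (fun=> x * spin_matching k 0 (spin_card false A).-2)); last first.
    move=> z /andP[zA _]; rewrite (IH _ (cD _ _ hA zA)); congr (_ * _).
    rewrite ct; last by rewrite (subset_trans (subD1set _ _)) ?subD1set.
    rewrite [in RHS](spin_cardD1 _ hA) [in RHS](spin_cardD1 _ zA).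
    have zA' : z \in A by move: zA; rewrite !inE => /andP[].
    by rewrite !nt.
  rewrite sumr_const [in RHS]/= mulr_natl; congr (_ *+ _).
  rewrite fA (cardsD1 h) hA add1n /=; apply: eq_card => z.
  rewrite -[LHS]/((z \in (A :\ h)%SET) && (tau z == tau h)) !inE.
  by case: (boolP (z \in A)) => [zA|]; rewrite ?andbF // !nt // eqxx andbT.
have /card_gt0P[h] := p0; rewrite !inE eqb_id => /andP[hA th].
have tE : spin_card true A = (spin_card true (A :\ h)%SET).+1.
  by rewrite (spin_cardD1 true hA) th.
have fE : spin_card false A = spin_card false (A :\ h)%SET.
  by rewrite (spin_cardD1 false hA) th.
rewrite (sumD h hA) tE fE /=; congr (_ + _).
  rewrite (eq_bigr (fun=> x * spin_matching k (spin_card true (A :\ h)%SET).-1 (spin_card false (A :\ h)%SET))).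
    rewrite sumr_const mulr_natl; congr (_ *+ _).
    apply: eq_card => z; rewrite -[LHS]/((z \in (A :\ h)%SET) && (tau z == tau h)).
    by rewrite !inE th.
  move=> z /andP[zA]; rewrite th => tz; rewrite (IH _ (cD _ _ hA zA)); congr (_ * _).
  by rewrite (spin_cardD1 true zA) (spin_cardD1 false zA) (eqP tz).
rewrite (eq_bigr (fun=> y * spin_matching k (spin_card true (A :\ h)%SET) (spin_card false (A :\ h)%SET).-1)).
  rewrite sumr_const mulr_natl; congr (_ *+ _).
  apply: eq_card => z; rewrite -[LHS]/((z \in (A :\ h)%SET) && (tau z != tau h)).
  by rewrite !inE th; case: (tau z).
move=> z /andP[zA]; rewrite th => tz; rewrite (IH _ (cD _ _ hA zA)); congr (_ * _).
by rewrite (spin_cardD1 true zA) (spin_cardD1 false zA); move: tz; case: (tau z).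
Qed.

End finite_set.

(** The recursion favours plus points, so symmetry is proved through its combinatorial meaning:
    reversing all spins changes the weight of no pair. *)
Lemma spin_matchingC k m p : (m + p = k.*2)%N -> spin_matching k m p = spin_matching k p m.
Proof.
move=> mp.
pose tau (i : 'I_(m + p)) := (i < m)%N.
pose w (e : {set 'I_(m + p)}) := if [exists i in e, exists j in e, tau i != tau j] then y else x.
have wP (tau' : 'I_(m + p) -> bool) : (forall i j, (tau' i == tau' j) = (tau i == tau j)) ->
   forall i j : 'I_(m + p), i != j -> w [set i; j]%SET = if tau' i == tau' j then x else y.
  move=> e i j ij; rewrite e /w; case: ifPn => [/exists_inP[a + /exists_inP[b]]|].
    by rewrite !inE => /orP[]/eqP-> /orP[]/eqP->; rewrite ?eqxx // 1?eq_sym => /negPf->.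
  case: (boolP (tau i == tau j)) => // tij /negP[].
  by apply/exists_inP; exists i; rewrite ?inE ?eqxx //; apply/exists_inP; exists j; rewrite ?inE ?eqxx ?orbT.
have ce : #|[set: 'I_(m + p)]%SET| = k.*2 by rewrite cardsT card_ord.
have c1 : #|[set h : 'I_(m + p) | tau h]%SET| = m.
  rewrite cardsE -sum1_card big_mkcond /= big_split_ord /=.
  rewrite (eq_bigr (fun=> 1%N)); last by move=> i _; rewrite ifT //; apply: (ltn_ord i).
  rewrite [X in (_ + X)%N]big1 ?addn0 ?sum1_card ?card_ord //.
  by move=> i _; rewrite ifF //; apply/negbTE; rewrite -leqNgt; apply: leq_addr.
have c2 : #|[set h : 'I_(m + p) | ~~ tau h]%SET| = p.
  apply/eqP; rewrite -(eqn_add2l m) -{1}c1; apply/eqP.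
  transitivity #|[set: 'I_(m + p)]%SET|; last by rewrite cardsT card_ord.
  rewrite -(cardsID [set h | tau h]%SET [set: 'I_(m + p)]%SET); congr (_ + _)%N.
    by apply: eq_card => z; rewrite !inE.
  by apply: eq_card => z; rewrite !inE andbT.
have s1 := matching_sum_spin (wP tau (fun _ _ => erefl)) ce.
have s2 := matching_sum_spin (wP (fun i => ~~ tau i) _) ce.
have {}s2 := s2 _; move: s1; rewrite s2; last first.
  by move=> i j; case: (tau i); case: (tau j).
have sc (s : 'I_(m + p) -> bool) b : spin_card s b [set: 'I_(m + p)]%SET = #|[set h | s h == b]%SET|.
  by apply: eq_card => z; rewrite !inE.
rewrite !sc.
have -> : [set h | ~~ tau h == true]%SET = [set h | ~~ tau h]%SET by apply/setP => h; rewrite !inE; case: (tau h).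
have -> : [set h | ~~ tau h == false]%SET = [set h | tau h]%SET by apply/setP => h; rewrite !inE; case: (tau h).
have -> : [set h | tau h == true]%SET = [set h | tau h]%SET by apply/setP => h; rewrite !inE; case: (tau h).
have -> : [set h | tau h == false]%SET = [set h | ~~ tau h]%SET by apply/setP => h; rewrite !inE; case: (tau h).
by rewrite c1 c2.
Qed.

(** Expansion at a minus point, the counterpart of the expansion built into the definition. A
    predecessor truncated at 0 has coefficient zero. *)
Lemma spin_matchingS k m p : (m + p = k.*2.+1)%N ->
  spin_matching k.+1 m p.+1 =
  p%:R * (x * spin_matching k m p.-1) + m%:R * (y * spin_matching k m.-1 p).
Proof.
move=> mp; rewrite spin_matchingC ?addnS ?mp //=; congr (_ + _).
  case: p mp => [|p] mp; first by rewrite !mul0r.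
  by rewrite spin_matchingC //=; move: mp; rewrite addnS addnC => -[].
case: m mp => [|m] mp; first by rewrite !mul0r.
by rewrite spin_matchingC //=; move: mp; rewrite addSn addnC => -[].
Qed.

End two_spin_matchings.

(** * The spin-flip ratio and the function F *)

Lemma le_norm_MVT (R : realType) (f df : R -> R) (q : R) :
  (forall x : R, is_derive x 1 f (df x)) -> (forall x, `|df x| <= q) ->
  forall x y, `|f x - f y| <= q * `|x - y|.
Proof.
move=> fdf dfq x y; wlog xy : x y / y <= x.
  by move=> wh; case: (leP y x) => [|/ltW] /wh //; rewrite distrC (distrC y).
have [|c _ ->] := @MVT_segment R f df y x xy (fun z _ => fdf z).
  apply: continuous_subspaceT => z; apply: differentiable_continuous.
  by apply/derivable1_diffP; apply: ex_derive.
by rewrite normrM ler_wpM2r.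
Qed.

Section contraction.
Variables (R : realType) (c : R).
Hypothesis c01 : 0 < c <= 1.

(** The map giving the flip ratio after one more pair is added; its argument is the old ratio times
    the odds of minus to plus points. *)
Definition mobius (z : R) : R := (1 + c * z) / (z + c).

(** In the coordinate [t = ln z] the map has derivative [-(1 - c^2) e / ((1 + c e)(e + c))] with
    [e = exp t], whose absolute value is largest at [e = 1]. *)
Lemma mobius_contraction (z1 z2 : R) : 0 < z1 -> 0 < z2 ->
  `|ln (mobius z1) - ln (mobius z2)| <= (1 - c) / (1 + c) * `|ln z1 - ln z2|.
Proof.
have [c0 c1] := andP c01.
pose g (t : R) := ln (1 + c * expR t) - ln (expR t + c).
pose dg (t : R) := (1 + c * expR t)^-1 * (c * expR t) - (expR t + c)^-1 * expR t.
have gE (z : R) : 0 < z -> ln (mobius z) = g (ln z).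
  move=> z0; rewrite /g lnK ?posrE // ln_div ?posrE //; nra.
have gd (t : R) : is_derive t 1 g (dg t).
  have e0 := expR_gt0 t.
  have h1 : is_derive t 1 (fun t : R => 1 + c * expR t) (c * expR t).
    have := is_deriveD (@is_derive_cst _ _ _ (1 : R) t 1) (@is_deriveZ _ _ _ _ c _ _ _ (is_derive_expR t)).
    by rewrite add0r.
  have h2 : is_derive t 1 (fun t : R => expR t + c) (expR t).
    have := is_deriveD (is_derive_expR t) (@is_derive_cst _ _ _ (c : R) t 1).
    by rewrite addr0.
  have p1 : 0 < 1 + c * expR t by nra.
  have p2 : 0 < expR t + c by nra.
  have k1 : is_derive (1 + c * expR t) 1 (@ln R) (1 + c * expR t)^-1 by exact: is_derive1_ln.
  have k2 : is_derive (expR t + c) 1 (@ln R) (expR t + c)^-1 by exact: is_derive1_ln.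
  exact: is_deriveB (@is_derive1_comp _ (@ln R) (fun t : R => 1 + c * expR t) _ _ _ k1 h1)
                    (@is_derive1_comp _ (@ln R) (fun t : R => expR t + c) _ _ _ k2 h2).
have dgq (t : R) : `|dg t| <= (1 - c) / (1 + c).
  have e0 := expR_gt0 t; rewrite /dg; set e := expR t in e0 *.
  rewrite (_ : _ - _ = - ((1 - c ^+ 2) * e / ((1 + c * e) * (e + c)))); last by field; apply/andP; split; nra.
  rewrite normrN ger0_norm; last first.
    by rewrite divr_ge0 ?mulr_ge0 //; nra.
  rewrite ler_pdivrMr; last by apply: mulr_gt0; nra.
  rewrite mulrAC ler_pdivlMr; last by nra.
  (* [(1 + c e) (e + c) - (1 + c)^2 e = c (1 - e)^2] *)
  have : 0 <= (1 - c) * (c * (1 - e) ^+ 2) by apply: mulr_ge0; [lra | apply: mulr_ge0; [lra | exact: sqr_ge0]].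
  by rewrite expr2; nra.
move=> z10 z20; rewrite !gE //; exact: (le_norm_MVT gd dgq).
Qed.

End contraction.

(** * The fixed point of the recursion and the convexity of its primitive *)

Section log_ratio.
Variables (R : realType) (beta : R).
Hypothesis beta_ge0 : 0 <= beta.

Let c : R := expR (- 2 * beta).
Let f : R -> R := f_fun beta.

Lemma expR_N2_itv : 0 < (expR (- 2 * beta) : R) <= 1.
Proof. by rewrite expR_gt0 expR_le1; have := beta_ge0; lra. Qed.

Let c0 : 0 < c. Proof. by case/andP: expR_N2_itv. Qed.
Let c1 : c <= 1. Proof. by case/andP: expR_N2_itv. Qed.

(** [f_fun] is the quadratic formula for [(1 - u) x^2 - c (1 - 2u) x - u = 0]: the expression under
    the root equals the discriminant [c^2 (1 - 2u)^2 + 4u (1 - u)]. *)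
Let f_spec (u : R) : 0 <= u <= 1 / 2 ->
  0 < f u /\ (1 - u) * f u ^+ 2 = c * (1 - 2 * u) * f u + u.
Proof.
move=> /andP[u0 u1]; rewrite /f /f_fun.
have -> : expR (- 4 * beta) = c ^+ 2 :> R.
  rewrite expr2 /c -expRD; congr (expR _); ring.
rewrite -/c; set D := 1 + _ * _ ^+ 2.
have DE : D = c ^+ 2 * (1 - 2 * u) ^+ 2 + 4 * u * (1 - u) by rewrite /D; ring.
have D0 : 0 <= D.
  by rewrite DE; apply: addr_ge0; [apply: mulr_ge0; exact: sqr_ge0 | nra].
have sD := sqr_sqrtr D0; set s := Num.sqrt D in sD *.
have s0 : 0 <= s by exact: sqrtr_ge0.
have ss : 0 < c * (1 - 2 * u) + s.
  have [u2|u2] := ltP u (1 / 2); first by apply: ltr_pwDl => //; apply: mulr_gt0 => //; lra.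
  (* At [u = 1/2] the linear term vanishes and positivity comes from the root, where [D = 1]. *)
  have uE : u = 1 / 2 by apply/eqP; rewrite eq_le u1 u2.
  rewrite uE (_ : 1 - 2 * (1 / 2) = 0); last by field.
  rewrite mulr0 add0r lt_neqAle s0 andbT eq_sym; apply/eqP => sz.
  move: sD; rewrite sz DE uE => /eqP; rewrite expr0n /= lt_eqF //.
  by rewrite (_ : _ + _ = 1) ?ltr01 //; field.
split; first by apply: divr_gt0 => //; lra.
have e : s ^+ 2 - c ^+ 2 * (1 - 2 * u) ^+ 2 - 4 * u * (1 - u) = 0 by rewrite sD DE; ring.
apply/eqP; rewrite -subr_eq0; apply/eqP.
rewrite -[RHS](mul0r ((4 * (1 - u))^-1)) -e; field; lra.
Qed.

Lemma f_fun_gt0 (u : R) : 0 <= u <= 1 / 2 -> 0 < f u.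
Proof. by move=> /f_spec[]. Qed.

(* [f u] is the positive root of an upward parabola with a nonpositive value at 0. *)
Let f_max (u r : R) : 0 <= u <= 1 / 2 -> 0 < r ->
  (1 - u) * r ^+ 2 <= c * (1 - 2 * u) * r + u -> r <= f u.
Proof.
move=> u01 r0; have [fu0 fE] := f_spec u01; case/andP: u01 => u0 u1.
move=> Q; rewrite leNgt; apply/negP => fr.
have h : 0 <= (1 - u) * f u - c * (1 - 2 * u).
  rewrite -(pmulr_lge0 _ fu0).
  suff -> : ((1 - u) * f u - c * (1 - 2 * u)) * f u = u by [].
  transitivity ((1 - u) * f u ^+ 2 - c * (1 - 2 * u) * f u); first by ring.
  by rewrite fE; ring.
have : 0 < (r - f u) * ((1 - u) * r + ((1 - u) * f u - c * (1 - 2 * u))).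
  apply: mulr_gt0; first by rewrite subr_gt0.
  by apply: ltr_pwDl => //; apply: mulr_gt0 => //; lra.
rewrite [ltRHS](_ : _ = (1 - u) * r ^+ 2 - c * (1 - 2 * u) * r
   - ((1 - u) * f u ^+ 2 - c * (1 - 2 * u) * f u)); last by ring.
by rewrite fE; lra.
Qed.

(** By [f_max] it suffices that [f u] satisfies the quadratic inequality at [v]. Passing from [u] to
    [v] adds the slack [(v - u) ((f u - c)^2 + 1 - c^2)], nonnegative since [0 < c <= 1]. *)
Lemma f_fun_le (u v : R) : 0 <= u -> u <= v -> v <= 1 / 2 -> f u <= f v.
Proof.
move=> u0 uv v1; have [fu0 fE] := @f_spec u ltac:(lra).
apply: f_max => //; first lra.
have h : 0 <= (v - u) * ((f u - c) ^+ 2 + (1 - c ^+ 2)).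
  apply: mulr_ge0; first lra.
  by apply: addr_ge0; [exact: sqr_ge0 | rewrite subr_ge0 exprn_ile1 // ltW].
have e : (1 - u) * f u ^+ 2 - (c * (1 - 2 * u) * f u + u) = 0 by rewrite fE subrr.
have E : c * (1 - 2 * v) * f u + v - (1 - v) * f u ^+ 2 =
    (v - u) * ((f u - c) ^+ 2 + (1 - c ^+ 2)) - ((1 - u) * f u ^+ 2 - (c * (1 - 2 * u) * f u + u)).
  by ring.
by rewrite -subr_ge0 E e subr0.
Qed.

Lemma f_fun0 : f 0 = c.
Proof.
have [fu0 fE] := @f_spec 0 ltac:(lra).
have : f 0 * (f 0 - c) = 0.
  by rewrite mulrBr -expr2; move: fE; rewrite subr0 mul1r mulr0 addr0 subr0 mulr1 => ->; ring.
by move/eqP; rewrite mulf_eq0 gt_eqF //= subr_eq0 => /eqP.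
Qed.

Lemma f_fun_half : f (1 / 2) = 1.
Proof.
have [fu0 fE] := @f_spec (1 / 2) ltac:(lra).
apply/eqP; rewrite -(@eqrXn2 _ 2) ?ltW // expr1n; apply/eqP.
have e : (1 - 2 * (1 / 2)) = 0 :> R by field.
rewrite e mulr0 mul0r add0r in fE.
apply: (@mulfI _ (1 - 1 / 2 : R)); first by lra.
by rewrite fE; field.
Qed.

(** Multiplied by [(m + p) / m], the quadratic equation for [f] at [m / (m + p)] becomes this
    fixed-point equation. *)
Lemma f_fun_mobius (m p : R) : 0 < m -> m <= p ->
  f (m / (m + p)) = mobius c (p / m * f (m / (m + p))).
Proof.
move=> m0 mp; set u := m / (m + p).
have u01 : 0 <= u <= 1 / 2.
  by rewrite divr_ge0 ?ler_pdivrMr /=; lra.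
have [fu0 fE] := f_spec u01.
have den : 0 < p / m * f u + c.
  by apply: addr_gt0 => //; apply: mulr_gt0 => //; apply: divr_gt0; lra.
rewrite /mobius; apply: (@mulIf _ _ (lt0r_neq0 den)); rewrite mulfVK ?lt0r_neq0 //.
have uE : 1 - u = p / (m + p) by rewrite /u; field; lra.
have u2E : 1 - 2 * u = (p - m) / (m + p) by rewrite /u; field; lra.
rewrite uE u2E in fE.
apply/eqP; rewrite -subr_eq0; apply/eqP.
have e : p / (m + p) * f u ^+ 2 - (c * ((p - m) / (m + p)) * f u + u) = 0 by rewrite fE subrr.
transitivity ((m + p) / m * (p / (m + p) * f u ^+ 2 - (c * ((p - m) / (m + p)) * f u + u))).
  by move: (f u) => w; rewrite /u; field; lra.
by rewrite e mulr0.
Qed.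

Definition log_ratio (u : R) : R := ln (f u).

Lemma log_ratio0 : log_ratio 0 = - 2 * beta.
Proof. by rewrite /log_ratio f_fun0 /c expRK. Qed.

Lemma log_ratio_le (u v : R) : 0 <= u -> u <= v -> v <= 1 / 2 -> log_ratio u <= log_ratio v.
Proof.
move=> u0 uv v1; rewrite /log_ratio ler_ln ?posrE ?f_fun_gt0 //; first exact: f_fun_le.
  lra.
lra.
Qed.

Lemma log_ratio_itv (u : R) : 0 <= u <= 1 / 2 -> - 2 * beta <= log_ratio u <= 0.
Proof.
move=> /andP[u0 u1]; rewrite -log_ratio0 log_ratio_le //=.
have -> : 0 = log_ratio (1 / 2) by rewrite /log_ratio f_fun_half ln1.
exact: log_ratio_le.
Qed.

Let mu := @lebesgue_measure R.

(** Measurability comes from monotonicity, which is available on [[0, 1/2]] only; hence the clamp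
    [t] onto that interval. *)
Lemma log_ratio_integrable (a b : itv_bound R) :
  [set` Interval a b] `<=` `[0, 1 / 2] ->
  mu.-integrable [set` Interval a b] (EFin \o log_ratio).
Proof.
move=> ab; pose t (x : R) := Num.max 0 (Num.min x (1 / 2)).
have t01 x : 0 <= t x <= 1 / 2.
  by rewrite /t le_max lexx /= ge_max ge_min lexx orbT divr_ge0.
have tE x : 0 <= x <= 1 / 2 -> t x = x.
  by move=> /andP[x0 x1]; rewrite /t min_l // max_r.
apply: measurable_bounded_integrable => //.
- apply: (@le_lt_trans _ _ (mu `[0, 1 / 2])); first by apply: le_measure; rewrite ?inE.
  by rewrite /mu lebesgue_measure_itv /= lte_fin divr_gt0 // ltry.
- apply: (@eq_measurable_fun _ _ _ _ _ (log_ratio \o t)).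
    by move=> x; rewrite inE => /ab; rewrite /= in_itv /= => x01; rewrite tE.
  apply: nondecreasing_measurable => // x y xy /=.
  apply: log_ratio_le; [by case/andP: (t01 x) | | by case/andP: (t01 y)].
  rewrite /t le_max2 // le_min2 //.
- exists (2 * beta); split; first exact: num_real.
  move=> M bM x /= /ab /=; rewrite in_itv /= => /log_ratio_itv.
  by rewrite ler_norml; lra.
Qed.

Lemma F_funE (t : R) : 0 <= t <= 1 / 2 -> F_fun beta t = \int[mu]_(u in `[0, t]) log_ratio u.
Proof. by move=> t01; rewrite /F_fun min_l //; lra. Qed.

Lemma F_funC (t : R) : F_fun beta (1 - t) = F_fun beta t.
Proof. by rewrite /F_fun minC subKr. Qed.

Lemma F_fun0 : F_fun beta 0 = 0.
Proof. by rewrite F_funE ?lexx ?divr_ge0 // set_itv1 Rintegral_set1. Qed.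

(** The integrand is nondecreasing; this is the convexity of [F_fun] on [[0, 1/2]] in quantitative
    form. *)
Lemma F_funB (a b : R) : 0 <= a -> a <= b -> b <= 1 / 2 ->
  log_ratio a * (b - a) <= F_fun beta b - F_fun beta a <= log_ratio b * (b - a).
Proof.
move=> a0 ab b1; rewrite !F_funE; [|lra|lra].
have ib : [set` `]a, b]] `<=` `[0 : R, 1 / 2].
  by move=> x /=; rewrite !in_itv /=; lra.
have ib0 : [set` `[0, b]] `<=` `[0 : R, 1 / 2].
  by move=> x /=; rewrite !in_itv /=; lra.
rewrite (Rintegral_itvB (log_ratio_integrable ib0)) ?bnd_simp //.
have cst (k : R) : \int[mu]_(x in `]a, b]) k = k * (b - a).
  rewrite Rintegral_cst // /mu /= lebesgue_measure_itv /= lte_fin.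
  by move: ab; rewrite le_eqVlt => /predU1P[->|->]; rewrite ?ltxx ?subrr ?mulr0.
have icst (k : R) : mu.-integrable `]a, b] (EFin \o (fun=> k)).
  apply: measurable_bounded_integrable => //.
    by rewrite /mu /= lebesgue_measure_itv /=; case: ifP => // _; rewrite -EFinB ltry.
  by exists `|k|; split; [exact: num_real | move=> M kM x _; exact: ltW].
rewrite -!cst; apply/andP; split; apply: le_Rintegral => //; try exact: log_ratio_integrable.
  by move=> x /=; rewrite in_itv /= => xab; apply: log_ratio_le; lra.
by move=> x /=; rewrite in_itv /= => xab; apply: log_ratio_le; lra.
Qed.

(* A subgradient of [F_fun beta] on [0, 1]. *)
Definition F_slope (a : R) : R := if a <= 1 / 2 then log_ratio a else - log_ratio (1 - a).

Lemma F_slope_bound (a : R) : 0 <= a <= 1 -> `|F_slope a| <= 2 * beta.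
Proof.
move=> a01; rewrite /F_slope; case: ifPn => ah; rewrite -?ltNge in ah; rewrite ler_norml.
  by have := @log_ratio_itv a ltac:(lra); lra.
by have := @log_ratio_itv (1 - a) ltac:(lra); lra.
Qed.

(** For [x > 1/2] reflect to [1 - x]: [F_fun] is unchanged, and the tangent line does not decrease
    because its slope is nonpositive. *)
Let F_tangent_left (a x : R) : 0 <= a <= 1 / 2 -> 0 <= x <= 1 ->
  F_fun beta a + log_ratio a * (x - a) <= F_fun beta x.
Proof.
move=> ah; have base (z : R) : 0 <= z <= 1 / 2 -> F_fun beta a + log_ratio a * (z - a) <= F_fun beta z.
  move=> zh; case: (leP a z) => az.
    by have := @F_funB a z ltac:(lra) az ltac:(lra); lra.
  by have := @F_funB z a ltac:(lra) (ltW az) ltac:(lra); lra.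
move=> x01; case: (leP x (1 / 2)) => xh; first by apply: base; lra.
rewrite -(F_funC x); apply: (le_trans _ (base (1 - x) _)); last lra.
have := log_ratio_itv ah; nra.
Qed.

Lemma F_fun_tangent (a x : R) : 0 <= a <= 1 -> 0 <= x <= 1 ->
  F_fun beta a + F_slope a * (x - a) <= F_fun beta x.
Proof.
move=> a01 x01; rewrite /F_slope; case: ifPn; first by move=> ah; apply: F_tangent_left; lra.
rewrite -ltNge => ah; rewrite -(F_funC a) -(F_funC x).
have := @F_tangent_left (1 - a) (1 - x) ltac:(lra) ltac:(lra); lra.
Qed.

End log_ratio.

Lemma spin_matching_gt0 (R : realType) (x y : R) k m p : 0 < x -> 0 < y ->
  (m + p = k.*2)%N -> 0 < spin_matching x y k m p.
Proof.
move=> x0 y0; elim: k m p => [|k IH] [|m] p //= mp.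
  by rewrite mulr_gt0 ?ltr0n ?mulr_gt0 ?IH //; lia.
have h1 : (0 < m)%N -> 0 < m%:R * (x * spin_matching x y k m.-1 p).
  by move=> m0; rewrite mulr_gt0 ?ltr0n ?mulr_gt0 ?IH //; lia.
have h2 : (0 < p)%N -> 0 < p%:R * (y * spin_matching x y k m p.-1).
  by move=> p0; rewrite mulr_gt0 ?ltr0n ?mulr_gt0 ?IH //; lia.
case: (posnP m) => [m0|m0].
  by rewrite m0 mul0r add0r -m0; apply: h2; lia.
case: (posnP p) => [p0|p0]; last by rewrite addr_gt0 ?h1 ?h2.
by rewrite [X in _ + X](_ : _ = 0) ?addr0 ?h1 // p0 mul0r.
Qed.

(** * Comparison of matching sums with F *)

Section matching_asymptotics.
Variables (R : realType) (beta : R).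
Hypothesis beta_ge0 : 0 <= beta.

Let c : R := expR (- 2 * beta).
Let b := spin_matching (expR beta) (expR (- beta)).
Let L : R -> R := log_ratio beta.

Let b_gt0 k m p : (m + p = k.*2)%N -> 0 < b k m p.
Proof. by apply: spin_matching_gt0; exact: expR_gt0. Qed.

(* Effect of flipping one minus point when [j] of the [2k] points are plus. *)
Definition flip_ratio k j : R := b k j.+1 (k.*2 - j.+1) / b k j (k.*2 - j).

Lemma flip_ratio_gt0 k j : (j < k)%N -> 0 < flip_ratio k j.
Proof. by move=> jk; rewrite /flip_ratio divr_gt0 ?b_gt0 //; lia. Qed.

Let cE : expR (- beta) = c * expR beta.
Proof. by rewrite /c -expRD; congr (expR _); ring. Qed.

(** When all points are minus, a flip turns exactly one pair from equal to opposite. *)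
Lemma flip_ratio0 k : flip_ratio k.+1 0 = c.
Proof.
rewrite /flip_ratio subn0.
have -> : (k.+1.*2 - 1 = k.*2.+1)%N by lia.
have -> : (k.+1.*2 = k.*2.+2)%N by lia.
have e0 := expR_gt0 beta; have b0 : 0 < b k 0 k.*2 by apply: b_gt0.
have k0 : (0 : R) < k.*2.+1%:R by rewrite ltr0n.
rewrite /b /= -/b mul0r add0r cE; field; lra.
Qed.

(** Expanding the numerator at a plus point and the denominator at a minus point produces the same
    two smaller matching sums. *)
Lemma flip_ratioS k j : (j < k)%N ->
  flip_ratio k.+1 j.+1 = mobius c ((k.*2 - j)%:R / j.+1%:R * flip_ratio k j).
Proof.
move=> jk; rewrite /flip_ratio.
have -> : (k.+1.*2 - j.+2 = k.*2 - j)%N by lia.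
have -> : (k.+1.*2 - j.+1 = (k.*2 - j).+1)%N by lia.
have e2 : b k.+1 j.+2 (k.*2 - j) = j.+1%:R * (expR beta * b k j (k.*2 - j))
   + (k.*2 - j)%:R * (expR (- beta) * b k j.+1 (k.*2 - j.+1)).
  by rewrite /b /= (_ : (k.*2 - j).-1 = k.*2 - j.+1)%N //; lia.
have e1 : b k.+1 j.+1 (k.*2 - j).+1 =
   (k.*2 - j)%:R * (expR beta * b k j.+1 (k.*2 - j.+1))
   + j.+1%:R * (expR (- beta) * b k j (k.*2 - j)).
  rewrite /b spin_matchingS; last by lia.
  by rewrite (_ : (k.*2 - j).-1 = k.*2 - j.+1)%N //; lia.
rewrite e1 e2 cE.
have b1 : 0 < b k j (k.*2 - j) by apply: b_gt0; lia.
have b2 : 0 < b k j.+1 (k.*2 - j.+1) by apply: b_gt0; lia.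
have e0 := expR_gt0 beta; have cp : 0 < c by exact: expR_gt0.
have m0 : (0 : R) < j.+1%:R by rewrite ltr0n.
have p0 : (0 : R) < (k.*2 - j)%:R by rewrite ltr0n; lia.
rewrite /mobius; move: (b k j _) b1 (b k j.+1 _) b2 => B1 B10 B2 B20.
move: (_%:R) m0 (_%:R) p0 => M M0 Q Q0.
field; rewrite ?gt_eqF ?addr_gt0 ?mulr_gt0 //.
Qed.

(** Density of plus points among the [2k - 1] points other than the flipped one. With this
    denominator the odds in [flip_ratioS] are exactly those in [f_fun_mobius]. *)
Let u k j : R := j%:R / k.*2.-1%:R.

Let u_itv k j : (j < k)%N -> 0 <= u k j <= 1 / 2.
Proof.
move=> jk; rewrite /u divr_ge0 //= ler_pdivrMr ?ltr0n; last by lia.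
by rewrite mulrAC ler_pdivlMr // mul1r -natrM ler_nat; lia.
Qed.

Let frac_le (m n m' n' : nat) : (0 < n)%N -> (0 < n')%N -> (m * n' <= m' * n)%N ->
  (m%:R / n%:R : R) <= m'%:R / n'%:R.
Proof.
move=> n0 n0' h; rewrite ler_pdivrMr ?ltr0n // mulrAC ler_pdivlMr ?ltr0n //.
by rewrite -!natrM ler_nat.
Qed.

Let u_upper k j : (j < k)%N -> u k j <= j.+1%:R / k.+1.*2.-1%:R.
Proof. by move=> jk; apply: frac_le; lia. Qed.

Let u_lower k j : (j < k)%N -> j%:R / k.+1.*2.-1%:R <= u k j.
Proof. by move=> jk; apply: frac_le; lia. Qed.

Let u_ge k j : (j < k)%N -> j%:R / k.*2%:R <= u k j.
Proof. by move=> jk; apply: frac_le; lia. Qed.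

Let u_le k j : (j < k)%N -> u k j <= j.+1%:R / k.*2%:R.
Proof. by move=> jk; apply: frac_le; lia. Qed.

(* With [q] the contraction factor, the bound is the fixed point of
   [x |-> q (x + 2 beta)]; the term [2 beta] bounds a telescoping sum, since the
   points [j / (2k - 1)] interlace with the points [j / (2k + 1)]. *)
Lemma flip_ratio_log_ratio k :
  \sum_(j < k) `|ln (flip_ratio k j) - L (j%:R / k.*2.-1%:R)| <= beta * (1 - c) / c.
Proof.
have /andP[c0 c1] := expR_N2_itv beta_ge0; rewrite -/c in c0 c1.
elim: k => [|k IH].
  by rewrite big_ord0 divr_ge0 ?mulr_ge0 ?subr_ge0 // ltW.
pose q := (1 - c) / (1 + c).
have q0 : 0 <= q by apply: divr_ge0; lra.
(* The term [j = 0] vanishes: both the ratio and the fixed point equal [c]. *)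
rewrite big_ord_recl /= flip_ratio0 mul0r /L log_ratio0 // /c expRK subrr normr0 add0r -/c -/L.
(* Both logarithms come from images under the same Moebius map, so the contraction applies. Moving
   the comparison point from [v] to [u k j] costs at most the increment of [L] from [v0] to [v]. *)
have step (j : 'I_k) : `|ln (flip_ratio k.+1 j.+1) - L (j.+1%:R / k.+1.*2.-1%:R)| <=
    q * (`|ln (flip_ratio k j) - L (u k j)| +
         (L (j.+1%:R / k.+1.*2.-1%:R) - L (j%:R / k.+1.*2.-1%:R))).
  have jk := ltn_ord j.
  have jk2 : (0 < k.*2 - j)%N by clear -jk; lia.
  have jk3 : (j < k.*2 - j)%N by clear -jk; lia.
  set v := j.+1%:R / _; set v0 := j%:R / _.
  have v01 : 0 <= v <= 1 / 2.
    rewrite /v divr_ge0 //= ler_pdivrMr ?ltr0n; last by lia.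
    by rewrite mulrAC ler_pdivlMr // mul1r -natrM ler_nat; lia.
  have vE : v = j.+1%:R / (j.+1%:R + (k.*2 - j)%:R).
    by rewrite /v -natrD; congr (_ / _%:R); lia.
  have r0 := flip_ratio_gt0 jk.
  have f0 : 0 < f_fun beta v by exact: f_fun_gt0.
  have z0 : (0 : R) < (k.*2 - j)%:R / j.+1%:R by rewrite divr_gt0 ?ltr0n.
  rewrite flip_ratioS // {1}/L /log_ratio {1}vE f_fun_mobius ?ltr0n ?ler_nat //.
  have z1 := mulr_gt0 z0 r0; have z2 := mulr_gt0 z0 f0.
  rewrite -vE; apply: le_trans (mobius_contraction _ z1 z2) _; first by rewrite c0 c1.
  have lnE (x : R) : 0 < x -> ln ((k.*2 - j)%:R / j.+1%:R * x) = ln ((k.*2 - j)%:R / j.+1%:R) + ln x.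
    by move=> x0; rewrite lnM ?posrE.
  rewrite -/q ler_wpM2l // lnE // lnE // opprD addrACA subrr add0r.
  rewrite -/(log_ratio beta v) -/L.
  have uv : u k j <= v := u_upper jk.
  have vu : v0 <= u k j := u_lower jk.
  have v00 : 0 <= v0 by rewrite divr_ge0.
  have Luv : L (u k j) <= L v by apply: log_ratio_le => //; [case/andP: (u_itv jk) | case/andP: v01].
  have Lvu : L v0 <= L (u k j) by apply: log_ratio_le => //; case/andP: (u_itv jk).
  rewrite (_ : ln _ - L v = (ln (flip_ratio k j) - L (u k j)) + (L (u k j) - L v)); last by ring.
  apply: le_trans (ler_normD _ _) _; rewrite lerD2l ler0_norm; lra.
have -> : \sum_(i < k) `|ln (flip_ratio k.+1 (bump 0 i)) - L ((bump 0 i)%:R / (k.*2).+1%:R)|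
   = \sum_(j < k) `|ln (flip_ratio k.+1 j.+1) - L (j.+1%:R / k.+1.*2.-1%:R)| by [].
apply: le_trans (ler_sum _ (fun j _ => step j)) _.
rewrite -mulr_sumr big_split /=.
rewrite -(big_mkord xpredT (fun j => L (j.+1%:R / (k.*2).+1%:R) - L (j%:R / (k.*2).+1%:R))).
rewrite (telescope_sumr (fun j => L (j%:R / (k.*2).+1%:R))) // mul0r.
have Lk : L (k%:R / (k.*2).+1%:R) - L 0 <= 2 * beta.
  have : - 2 * beta <= L (k%:R / (k.*2).+1%:R) <= 0.
    apply: log_ratio_itv => //; rewrite divr_ge0 //= ler_pdivrMr ?ltr0n //.
    by rewrite mulrAC ler_pdivlMr // mul1r -natrM ler_nat; lia.
  by rewrite /L log_ratio0 //; lra.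
apply: (@le_trans _ _ (q * (beta * (1 - c) / c + 2 * beta))); first by rewrite ler_wpM2l // lerD.
by rewrite /q le_eqVlt; apply/orP; left; apply/eqP; field; lra.
Qed.

(** Both quantities telescope over the flips. The log-ratios are summably close to [L] at the points
    [u k j]; as [u k j] lies between [w j] and [w j.+1], so does its value of [L] relative to the
    scaled increment of [F_fun], and the remaining error telescopes to at most [2 beta]. *)
Lemma ln_spin_matching_half k m : (m <= k)%N ->
  `|ln (b k m (k.*2 - m)) - ln (b k 0 k.*2) - k.*2%:R * F_fun beta (m%:R / k.*2%:R)|
    <= beta * (1 - c) / c + 2 * beta.
Proof.
move=> mk.
have /andP[c0 c1] := expR_N2_itv beta_ge0; rewrite -/c in c0 c1.
have [k0|k0] := posnP k.
  move: mk; rewrite k0 leqn0 => /eqP->; rewrite subn0 subrr sub0r mul0r oppr0 normr0.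
  by rewrite addr_ge0 ?mulr_ge0 ?invr_ge0 ?subr_ge0 ?(ltW c0).
have -> : ln (b k m (k.*2 - m)) - ln (b k 0 k.*2) = \sum_(j < m) ln (flip_ratio k j).
  rewrite -(big_mkord xpredT (fun j => ln (flip_ratio k j))).
  rewrite (eq_big_nat _ _ (F2 := fun j => ln (b k j.+1 (k.*2 - j.+1)) - ln (b k j (k.*2 - j)))).
    by rewrite (telescope_sumr (fun j => ln (b k j (k.*2 - j)))) // subn0.
  by move=> j /andP[_ jm]; rewrite /flip_ratio ln_div // posrE b_gt0 //; lia.
have kk : (0 : R) < k.*2%:R by rewrite ltr0n; lia.
pose w (j : nat) : R := j%:R / k.*2%:R.
have -> : k.*2%:R * F_fun beta (m%:R / k.*2%:R) =
    \sum_(j < m) k.*2%:R * (F_fun beta (w j.+1) - F_fun beta (w j)).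
  rewrite -(big_mkord xpredT (fun j => k.*2%:R * (F_fun beta (w j.+1) - F_fun beta (w j)))).
  rewrite -big_distrr /= (telescope_sumr (fun j => F_fun beta (w j))) //.
  by rewrite /w mul0r F_fun0 // subr0.
rewrite -sumrB.
rewrite (eq_bigr (fun j : 'I_m => (ln (flip_ratio k j) - L (u k j)) +
   (L (u k j) - k.*2%:R * (F_fun beta (w j.+1) - F_fun beta (w j))))); last by move=> j _; ring.
rewrite big_split /=; apply: le_trans (ler_normD _ _) _; apply: lerD.
  apply: le_trans (ler_norm_sum _ _ _) _; apply: le_trans (flip_ratio_log_ratio k).
  rewrite -(big_mkord xpredT (fun j => `|ln (flip_ratio k j) - L (u k j)|)).
  rewrite -(big_mkord xpredT (fun j => `|ln (flip_ratio k j) - L (u k j)|)).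
  rewrite (big_cat_nat (n := m) _ mk) //= lerDl.
  by apply: sumr_ge0.
have w0 j : 0 <= w j by rewrite /w divr_ge0 // ltW.
have wh j : (j <= m)%N -> w j <= 1 / 2.
  move=> jm; rewrite /w ler_pdivrMr // mulrAC ler_pdivlMr // mul1r -natrM ler_nat; lia.
have ww j : w j <= w j.+1 by rewrite /w ler_pM2r ?invr_gt0 // ler_nat.
apply: (@le_trans _ _ (\sum_(j < m) (L (w j.+1) - L (w j)))).
  apply: le_trans (ler_norm_sum _ _ _) _; apply: ler_sum => j _.
  have jm := ltn_ord j.
  have := F_funB beta_ge0 (w0 j) (ww j) (wh j.+1 jm).
  rewrite (_ : w j.+1 - w j = k.*2%:R^-1); last first.
    by rewrite /w -mulrBl -natrB // subSnn mul1r.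
  rewrite ler_pdivrMr // ler_pdivlMr // -/L => /andP[F1 F2].
  have wu : w j <= u k j := u_ge (leq_trans jm mk).
  have uw : u k j <= w j.+1 := u_le (leq_trans jm mk).
  have L1 : L (w j) <= L (u k j).
    by apply: log_ratio_le => //; case/andP: (u_itv (leq_trans jm mk)).
  have L2 : L (u k j) <= L (w j.+1).
    by apply: log_ratio_le => //; [exact: le_trans wu | exact: wh].
  rewrite ler_norml [k.*2%:R * _]mulrC; apply/andP; split; lra.
rewrite -(big_mkord xpredT (fun j => L (w j.+1) - L (w j))) (telescope_sumr (fun j => L (w j))) //.
have := @log_ratio_itv _ _ beta_ge0 (w m) ltac:(by rewrite w0 wh).
by rewrite /w mul0r /L log_ratio0 //; lra.
Qed.

Lemma ln_spin_matching k m : (m <= k.*2)%N ->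
  `|ln (b k m (k.*2 - m)) - ln (b k 0 k.*2) - k.*2%:R * F_fun beta (m%:R / k.*2%:R)|
    <= beta * (1 - c) / c + 2 * beta.
Proof.
move=> mk; case: (leqP m k) => [|km]; first exact: ln_spin_matching_half.
rewrite /b spin_matchingC ?subnKC // -/b -F_funC.
have -> : 1 - m%:R / k.*2%:R = (k.*2 - m)%:R / k.*2%:R :> R.
  rewrite natrB // mulrBl divff // pnatr_eq0; lia.
have := @ln_spin_matching_half k (k.*2 - m) ltac:(lia).
by rewrite subKn.
Qed.

End matching_asymptotics.

(** * Bounds on the annealed partition function *)

(** All pairs are equal, so every matching weighs [x ^+ k]; the factor with unit weights counts the
    matchings. *)
Lemma spin_matching_same (R : comNzRingType) (x y : R) k :
  spin_matching x y k 0 k.*2 = x ^+ k * spin_matching 1 1 k 0 k.*2.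
Proof.
elim: k => [|k IH] /=; first by rewrite expr0 mulr1.
by rewrite IH exprS; ring.
Qed.

Section annealed_partition_function.
Variables (R : realType) (n : nat) (d : 'I_n -> nat) (k : nat).
Hypothesis dk : total_degree d = k.*2.
Variables (beta B : R).
Hypothesis beta_ge0 : 0 <= beta.

Let b := spin_matching (expR beta) (expR (- beta)).
Let H := half_edge d.

Definition plus_degree (sigma : {ffun 'I_n -> bool}) : nat := \sum_(i < n) d i * sigma i.

Lemma plus_degree_le sigma : (plus_degree sigma <= k.*2)%N.
Proof.
rewrite -dk /plus_degree /total_degree; apply: leq_sum => i _.
by case: (sigma i); rewrite ?muln1 ?muln0.
Qed.

Lemma card_half_edge (s : 'I_n -> bool) :
  #|[set h : H | s (tag h)]%SET| = (\sum_(i < n) d i * s i)%N.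
Proof.
rewrite cardsE -sum1_card.
transitivity (\sum_(p : {i : 'I_n & 'I_(d i)} | s (tag p) && true) 1)%N.
  by apply: eq_bigl => h; rewrite andbT.
rewrite -(sig_big_dep (fun i => s i) (fun i (j : 'I_(d i)) => true) (fun i j => 1%N)).
rewrite big_mkcond /=; apply: eq_bigr => i _.
by case: (s i); rewrite ?muln0 // sum1_card card_ord muln1.
Qed.

Lemma card_half_edges : #|[set: H]%SET| = k.*2.
Proof.
rewrite -dk (_ : [set: H]%SET = [set h : H | true]%SET); last by apply/setP => h; rewrite !inE.
rewrite (card_half_edge (fun=> true)); apply: eq_bigr => i _; exact: muln1.
Qed.

Lemma matching_sum_half_edge (w : {set H} -> R) (x y : R) (s : 'I_n -> bool) :
  (forall h h', h != h' -> w [set h; h']%SET = if s (tag h) == s (tag h') then x else y) ->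
  \sum_(E in pairings d) \prod_(e in E) w e =
  spin_matching x y k (\sum_(i < n) d i * s i)%N (k.*2 - \sum_(i < n) d i * s i)%N.
Proof.
move=> wP.
transitivity (matching_sum w [set: H]%SET).
  by apply: eq_bigl => E; rewrite inE.
rewrite (matching_sum_spin (tau := fun h => s (tag h)) wP card_half_edges).
have c1 : spin_card (fun h : H => s (tag h)) true [set: H]%SET = (\sum_(i < n) d i * s i)%N.
  by rewrite -card_half_edge; apply: eq_card => h; rewrite !inE eqb_id.
by rewrite -c1 -card_half_edges -(spin_card_sum (fun h : H => s (tag h))) addKn.
Qed.

Lemma card_pairings : #|pairings d|%:R = spin_matching 1 1 k 0 k.*2 :> R.
Proof.
have := @matching_sum_half_edge (fun=> 1) 1 1 (fun=> false) (fun _ _ _ => erefl).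
have e0 : (\sum_(i < n) d i * false = 0)%N by rewrite big1 // => i _; rewrite muln0.
rewrite e0 subn0 => <-.
rewrite (eq_bigr (fun=> 1)); last by move=> E _; rewrite big1.
by rewrite sumr_const.
Qed.

(** For fixed spins the exponential of the edge sum is a product over pairs, with one factor for
    equal and one for opposite spins, so its sum over pairings depends only on the plus degree. *)
Lemma CM_expectation_partition_function :
  CM_expectation (partition_function (d := d) beta B) =
  \sum_(sigma : {ffun 'I_n -> bool}) expR (B * \sum_(i < n) spin R (sigma i))
    * (b k (plus_degree sigma) (k.*2 - plus_degree sigma) / spin_matching 1 1 k 0 k.*2).
Proof.
rewrite /CM_expectation card_pairings /partition_function exchange_big /= mulr_suml.
apply: eq_bigr => sigma _; rewrite mulrA; congr (_ / _).
rewrite /b /plus_degree.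
rewrite -(@matching_sum_half_edge (fun e => expR (beta * \prod_(h in e) spin R (sigma (tag h)))) _ _ sigma); last first.
  move=> h h' hh; rewrite big_setU1 ?inE //= big_set1 /spin.
  by case: (sigma (tag h)); case: (sigma (tag h')) => /=; rewrite ?mulr1 ?mul1r ?mulrN1 ?opprK ?mulN1r ?mulr1.
rewrite mulr_sumr; apply: eq_bigr => E _.
by rewrite expRD mulrC; congr (_ * _); rewrite mulr_sumr expR_sum.
Qed.

(** Logarithm of the partition function of a single vertex of degree [j] in the field [B], with a
    factor [expR theta] for each plus half-edge. *)
Definition tilted_free_energy (theta : R) (j : nat) : R :=
  ln (expR (B + theta * j%:R) + expR (- B)).

Lemma sum_spins_tilted (theta : R) :
  \sum_(sigma : {ffun 'I_n -> bool})
     expR (B * (\sum_(i < n) spin R (sigma i)) + theta * (plus_degree sigma)%:R) =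
  expR (\sum_(i < n) tilted_free_energy theta (d i)).
Proof.
rewrite expR_sum.
transitivity (\prod_(i < n) \sum_(s : bool) expR (B * spin R s + theta * (d i * s)%:R)).
  rewrite bigA_distr_bigA; apply: eq_bigr => sigma _.
  rewrite -expR_sum big_split /= -mulr_sumr; congr (expR (_ + _)).
  by rewrite /plus_degree natr_sum mulr_sumr.
apply: eq_bigr => i _; rewrite big_bool /tilted_free_energy lnK ?posrE ?addr_gt0 ?expR_gt0 //.
by rewrite /spin muln1 muln0 mulr1 mulr0 addr0 mulrN1.
Qed.

Let C := beta * (1 - expR (- 2 * beta)) / expR (- 2 * beta) + 2 * beta.
Let ell : R := k.*2%:R.

Let weight (sigma : {ffun 'I_n -> bool}) : R :=
  expR (B * (\sum_(i < n) spin R (sigma i)) + ell * F_fun beta ((plus_degree sigma)%:R / ell)).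

(** [ln_spin_matching] approximates each matching sum with an error [C] independent of the spins;
    the factor with [beta * k%:R] is the contribution of aligned spins. *)
Let CM_expectation_bounds :
  expR (beta * k%:R - C) * \sum_sigma weight sigma <=
  CM_expectation (partition_function (d := d) beta B) <=
  expR (beta * k%:R + C) * \sum_sigma weight sigma.
Proof.
rewrite CM_expectation_partition_function.
have N0 : 0 < spin_matching 1 1 k 0 k.*2 :> R by apply: spin_matching_gt0.
have bE : b k 0 k.*2 = expR (beta * k%:R) * spin_matching 1 1 k 0 k.*2.
  by rewrite /b spin_matching_same expRM_natr.
have key sigma : b k (plus_degree sigma) (k.*2 - plus_degree sigma) / spin_matching 1 1 k 0 k.*2 =
    expR (beta * k%:R + (ln (b k (plus_degree sigma) (k.*2 - plus_degree sigma)) - ln (b k 0 k.*2))).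
  have m0 := plus_degree_le sigma.
  have b1 : 0 < b k (plus_degree sigma) (k.*2 - plus_degree sigma).
    by apply: spin_matching_gt0; rewrite ?expR_gt0 ?subnKC.
  have b2 : 0 < b k 0 k.*2 by apply: spin_matching_gt0; rewrite ?expR_gt0.
  rewrite expRD expRB !lnK ?posrE // bE; field.
  by rewrite !gt_eqF ?expR_gt0.
rewrite !mulr_sumr; apply/andP; split; apply: ler_sum => sigma _;
  rewrite key /weight -!expRD ler_expR;
  have := ln_spin_matching beta_ge0 (plus_degree_le sigma);
  rewrite -/b -/ell -/C ler_norml; lra.
Qed.

(** Logarithm of the sum of weights once [F_fun] is replaced by its tangent line at [a]. *)
Let tangent_sum (a : R) : R := ell * (F_fun beta a - a * F_slope beta a)
  + \sum_(i < n) tilted_free_energy (F_slope beta a) (d i).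

Let tangent_sumE (a : R) : expR (tangent_sum a) =
  \sum_(sigma : {ffun 'I_n -> bool})
    expR (B * (\sum_(i < n) spin R (sigma i)) +
      (ell * (F_fun beta a - a * F_slope beta a) + F_slope beta a * (plus_degree sigma)%:R)).
Proof.
rewrite /tangent_sum expRD -sum_spins_tilted mulr_sumr; apply: eq_bigr => sigma _.
by rewrite -expRD addrCA.
Qed.

Hypothesis k_gt0 : (0 < k)%N.

Let ell0 : 0 < ell. Proof. by rewrite ltr0n double_gt0. Qed.

Let plus_itv sigma : 0 <= (plus_degree sigma)%:R / ell <= 1.
Proof.
by rewrite divr_ge0 ?(ltW ell0) //= ler_pdivrMr // mul1r ler_nat plus_degree_le.
Qed.

(** By convexity every tangent line lies below [F_fun], so the decoupled sum bounds the weights from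
    below term by term. *)
Lemma ln_CM_expectation_ge (a : R) : 0 <= a <= 1 ->
  beta * k%:R - C + (k.*2%:R * (F_fun beta a - a * F_slope beta a)
    + \sum_(i < n) tilted_free_energy (F_slope beta a) (d i))
  <= ln (CM_expectation (partition_function (d := d) beta B)).
Proof.
move=> a01; rewrite -/ell -/(tangent_sum a) -ler_expR.
have /andP[lo _] := CM_expectation_bounds.
suff h : expR (beta * k%:R - C + tangent_sum a) <= expR (beta * k%:R - C) * \sum_sigma weight sigma.
  have h2 := le_trans h lo; rewrite lnK // posrE; apply: lt_le_trans h2; exact: expR_gt0.
rewrite expRD ler_wpM2l ?expR_ge0 // tangent_sumE; apply: ler_sum => sigma _.
rewrite ler_expR lerD2l; have := F_fun_tangent beta_ge0 a01 (plus_itv sigma).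
rewrite -(ler_pM2l ell0) => /(le_trans _); apply.
rewrite le_eqVlt; apply/orP; left; apply/eqP; field; exact: lt0r_neq0.
Qed.

(** The tangent at [m / ell] is exact on configurations of plus degree [m]. Summing over the
    [2k + 1] possible [m] covers all configurations, and [a] is the point with the largest
    summand. *)
Lemma ln_CM_expectation_le : exists2 a : R, 0 <= a <= 1 &
  ln (CM_expectation (partition_function (d := d) beta B)) <=
  beta * k%:R + C + ln (k.*2.+1%:R) + (k.*2%:R * (F_fun beta a - a * F_slope beta a)
    + \sum_(i < n) tilted_free_energy (F_slope beta a) (d i)).
Proof.
pose t (j : 'I_k.*2.+1) : R := j%:R / ell.
pose j0 := [arg max_(j > ord0) tangent_sum (t j)]%O.
have j0P j : tangent_sum (t j) <= tangent_sum (t j0).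
  by rewrite /j0; case: arg_maxP => //= i _; apply.
exists (t j0).
  rewrite /t divr_ge0 ?(ltW ell0) //= ler_pdivrMr // mul1r ler_nat -ltnS; exact: ltn_ord.
rewrite -/ell -/(tangent_sum _).
have /andP[lo up] := CM_expectation_bounds.
have W0 : 0 < \sum_sigma weight sigma.
  rewrite (bigD1 [ffun=> true]) //= ltr_pwDl ?expR_gt0 // sumr_ge0 // => s _; exact: expR_ge0.
have E0 : 0 < CM_expectation (partition_function (d := d) beta B).
  by apply: lt_le_trans lo; rewrite mulr_gt0 ?expR_gt0.
rewrite -ler_expR lnK //; apply: le_trans up _.
rewrite -[_ + ln _ + _]addrA [leRHS]expRD ler_wpM2l ?expR_ge0 // [leRHS]expRD lnK ?posrE ?ltr0n //.
apply: (@le_trans _ _ (\sum_(j < k.*2.+1) expR (tangent_sum (t j)))).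
  under [leRHS]eq_bigr do rewrite tangent_sumE.
  rewrite exchange_big /=; apply: ler_sum => sigma _.
  have mk : (plus_degree sigma < k.*2.+1)%N by rewrite ltnS plus_degree_le.
  rewrite (bigD1 (Ordinal mk)) //= /weight /t /=.
  apply: ler_wpDr; first by apply: sumr_ge0 => j _; exact: expR_ge0.
  rewrite ler_expR lerD2l le_eqVlt; apply/orP; left; apply/eqP; field; exact: lt0r_neq0.
apply: (@le_trans _ _ (\sum_(j < k.*2.+1) expR (tangent_sum (t j0)))).
  by apply: ler_sum => j _; rewrite ler_expR.
by rewrite sumr_const card_ord mulr_natl.
Qed.

End annealed_partition_function.

(** * The limiting degree distribution *)

Section cdf_continuity.
Context (R : realType) (disp : measure_display) (T : measurableType disp).
Variables (P : probability T R) (X : {RV P >-> R}).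

Local Notation nu := (distribution P X).

Lemma cdf_fin_num (x : R) : cdf X x \is a fin_num.
Proof. exact: fin_num_measure. Qed.

Lemma cdfB (x y : R) : x <= y -> (cdf X y = cdf X x + nu `]x, y])%E.
Proof.
move=> xy; rewrite /cdf.
have -> : `]-oo, y]%classic = `]-oo, x]%classic `|` `]x, y]%classic.
  by apply/seteqP; split => z /=; rewrite !in_itv /=; [case: (leP z x) => h; [left|right] | move=> []; lra].
rewrite measureU //.
by rewrite -subset0 => z /=; rewrite !in_itv /=; lra.
Qed.

(** Right continuity always holds. On the left, without an atom [cdf X x] is the limit along
    [x - 1/(n + 1)], and monotonicity extends this to all nearby points. *)
Lemma pmf0_cdf_continuous (x : R) : pmf X x = 0 -> {for x, continuous (cdf X)}.
Proof.
move=> px.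
have nx : nu [set x] = 0%E.
  have := px; rewrite /pmf -[P _]/(nu [set x]) => h.
  by rewrite -[LHS]fineK ?h // fin_num_measure.
have fin := cdf_fin_num.
apply/left_right_continuousP; split; last exact: cdf_right_continuous.
have cdfE : cdf X x = nu (\bigcup_n `]-oo, x - n.+1%:R^-1]%classic).
  have U : nu `]-oo, x[ = cdf X x.
    rewrite /cdf -[in RHS](@setUitv1 _ _ _ _ true) ?bnd_simp //.
    rewrite measureU //; first by rewrite [X in (_ + X)%E](_ : _ = 0%E) ?adde0.
    by apply/seteqP; split => z //= [h1 h2]; move: h1; rewrite h2 in_itv /= ltxx.
  rewrite -U; congr (nu _); apply/seteqP; split => z /=.
    rewrite in_itv /= => zx; have [k kz] := ltr_add_invr zx.
    by exists k => //=; rewrite in_itv /= lerBrDr ltW.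
  move=> [k _ /=]; rewrite !in_itv /= => h; apply: le_lt_trans h _.
  by rewrite ltrBlDr ltrDl invr_gt0.
have seq_cvg : nu `]-oo, x - n.+1%:R^-1]%classic @[n --> \oo] --> cdf X x.
  rewrite cdfE; apply: nondecreasing_cvg_mu => //.
    by apply: bigcup_measurable.
  move=> m n mn; apply/subsetPset => z /=; rewrite !in_itv /= => /le_trans; apply.
  by rewrite lerD2l lerN2 lef_pV2 ?posrE // ler_nat.
have fc : fine (nu `]-oo, x - n.+1%:R^-1]%classic) @[n --> \oo] --> fine (cdf X x).
  by apply: fine_cvg; rewrite fineK.
rewrite -(fineK (fin x)).
have -> : cdf X = EFin \o (fun y => fine (cdf X y)) by apply/funext => y /=; rewrite fineK.
apply: cvg_EFin; first by near=> y.
apply/cvgrPdist_lt => e e0.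
have /cvgrPdist_lt /(_ e e0) [N _ hN] := fc.
have xN : x - N.+1%:R^-1 < x by rewrite ltrBlDr ltrDl invr_gt0.
have := hN N (leqnn N); rewrite /= => hNN.
near=> y => /=.
have yx : y <= x by near: y; exact: nbhs_left_le.
have xy : x - N.+1%:R^-1 <= y by near: y; apply: nbhs_left_ge.
have m1 : fine (cdf X y) <= fine (cdf X x) by rewrite fine_le // cdf_nondecreasing.
have m2 : fine (cdf X (x - N.+1%:R^-1)) <= fine (cdf X y) by rewrite fine_le // cdf_nondecreasing.
move: hNN; rewrite -[nu _]/(cdf X _) => hNN.
rewrite ger0_norm; last by lra.
by move: hNN; rewrite ger0_norm; lra.
Unshelve. all: by end_near. Qed.

(** Otherwise every point of the interval would be an atom; atoms are countable, but the interval
    has positive length. *)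
Lemma cdf_continuity_dense (a b : R) : a < b ->
  exists2 x, a < x < b & {for x, continuous (cdf X)}.
Proof.
move=> ab; apply: contrapT => h.
have sub : `]a, b[%classic `<=` [set r | 0 < pmf X r].
  move=> x /=; rewrite in_itv /= => xab; rewrite lt_neqAle pmf_ge0 andbT eq_sym.
  by apply/eqP => px; apply: h; exists x => //; exact: pmf0_cdf_continuous.
have := countable_lebesgue_measure0 (sub_countable (subset_card_le sub) (pmf_gt0_countable X)).
rewrite lebesgue_measure_itv /= lte_fin ab => /eqP.
by rewrite -EFinB eqe subr_eq0 gt_eqF.
Qed.

End cdf_continuity.

Section degree_limit.
Context (R : realType).
Variable d : forall n : nat, 'I_n -> nat.
Arguments d : clear implicits.
Context (disp : measure_display) (T : measurableType disp).
Variables (P : probability T R) (D : {RV P >-> R}).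
Hypothesis D_ge1 : P [set w | 1 <= D w] = 1%E.
Hypothesis degree_cvg : cvg_in_distribution (fun n => @degree_cdf n (d n) R) D.

Local Notation nu := (distribution P D).

Definition degree_frac (n k : nat) : R := #|[set i : 'I_n | d n i == k]%SET|%:R / n%:R.

Lemma natr_le_itv (m k : nat) (x : R) : k%:R <= x < k.+1%:R -> (m%:R <= x) = (m <= k)%N.
Proof.
move=> /andP[kx xk]; apply/idP/idP => [mx|mk].
  by rewrite -ltnS -(ltr_nat R); exact: le_lt_trans xk.
by apply: le_trans kx; rewrite ler_nat.
Qed.

Lemma degree_cdf_const n k (x y : R) : k%:R <= x < k.+1%:R -> k%:R <= y < k.+1%:R ->
  degree_cdf (d n) x = degree_cdf (d n) y.
Proof.
move=> hx hy; rewrite /degree_cdf; congr (#|pred_of_set _|%:R / _).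
by apply/setP => i; rewrite !inE (natr_le_itv _ hx) (natr_le_itv _ hy).
Qed.

Lemma degree_cdf_jump n k (x y : R) : k%:R <= x < k.+1%:R -> k.+1%:R <= y < k.+2%:R ->
  degree_cdf (d n) y - degree_cdf (d n) x = degree_frac n k.+1.
Proof.
move=> hx hy; rewrite /degree_cdf /degree_frac -mulrBl; congr (_ / _).
apply/eqP; rewrite subr_eq -natrD; apply/eqP; congr (_%:R).
rewrite addnC -(cardsID [set i | (d n i)%:R <= x]%SET); congr (_ + _)%N.
  by apply: eq_card => i; rewrite !inE (natr_le_itv _ hx) (natr_le_itv _ hy); lia.
by apply: eq_card => i; rewrite !inE (natr_le_itv _ hx) (natr_le_itv _ hy) eqn_leq -ltnNge andbC.
Qed.

(** The empirical distribution functions are constant between consecutive integers, so their limits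
    at two continuity points there agree. *)
Let nu_gap k (x y : R) : k%:R < x -> x <= y -> y < k.+1%:R ->
  {for x, continuous (cdf D)} -> {for y, continuous (cdf D)} -> nu `]x, y] = 0%E.
Proof.
move=> kx xy yk cx cy.
have xE : cdf D x = cdf D y.
  apply: cvg_unique (degree_cvg cx) _ => //.
  have := degree_cvg cy; apply: cvg_trans; apply: near_eq_cvg; near=> n.
  by rewrite (@degree_cdf_const n k x y) //; lra.
have := cdfB D xy; rewrite xE => /(congr1 fine); rewrite fineD ?fin_num_measure ?cdf_fin_num // => h.
by rewrite -[LHS]fineK ?fin_num_measure //; congr EFin; lra.
Unshelve. all: by end_near. Qed.

(** Integrality survives the weak limit: the open interval is covered by countably many half-open
    ones with continuity points as ends. *)
Lemma distribution_gap k : nu `]k%:R, k.+1%:R[ = 0%E.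
Proof.
(* The margin [1 / (j + 2)] is at most [1/2], which keeps the left end below the right one. *)
have ex (j : nat) : exists xy : R * R, [/\ k%:R < xy.1 < k%:R + (j.+2%:R)^-1,
    k.+1%:R - (j.+2%:R)^-1 < xy.2 < k.+1%:R,
    {for xy.1, continuous (cdf D)} & {for xy.2, continuous (cdf D)}].
  have j0 : (0 : R) < (j.+2%:R)^-1 by rewrite invr_gt0.
  have [x hx cx] := @cdf_continuity_dense _ _ _ _ D k%:R (k%:R + (j.+2%:R)^-1) ltac:(by rewrite ltrDl).
  have [y hy cy] := @cdf_continuity_dense _ _ _ _ D (k.+1%:R - (j.+2%:R)^-1) k.+1%:R ltac:(by rewrite ltrBlDr ltrDl).
  by exists (x, y).
have [xy xyP] := choice ex.
have jh (j : nat) : (j.+2%:R)^-1 <= 1 / 2 :> R.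
  by rewrite div1r lef_pV2 ?posrE // ler_nat.
have sub : `]k%:R, k.+1%:R[%classic `<=` \bigcup_j `](xy j).1, (xy j).2]%classic.
  move=> z /=; rewrite in_itv /= => /andP[kz zk].
  have [j1 h1] := ltr_add_invr kz; have [j2 h2] := ltr_add_invr zk.
  exists (maxn j1 j2) => //=; have [/andP[_ a] /andP[b _] _ _] := xyP (maxn j1 j2).
  have e1 : ((maxn j1 j2).+2%:R)^-1 <= (j1.+1%:R)^-1 :> R.
    by rewrite lef_pV2 ?posrE // ler_nat; lia.
  have e2 : ((maxn j1 j2).+2%:R)^-1 <= (j2.+1%:R)^-1 :> R.
    by rewrite lef_pV2 ?posrE // ler_nat; lia.
  rewrite in_itv /=; move: a b e1 e2 h1 h2.
  by move: (_.+2%:R^-1) (j1.+1%:R^-1) (j2.+1%:R^-1) => u v1 v2; lra.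
apply: subset_measure0 sub _ => //; first by apply: bigcup_measurable.
apply/negligibleP; first by apply: bigcup_measurable.
apply: negligible_bigcup => j; apply/negligibleP => //.
have [/andP[a1 a2] /andP[b1 b2] cx cy] := xyP j.
have := jh j; move: a1 a2 b1 b2; have := @natr1 R k; move: (_.+2%:R^-1) => u *.
by apply: (@nu_gap k) => //; lra.
Qed.

(** With continuity points in the two gaps around [k + 1], the increment of the distribution
    function is the mass at [k + 1], for the empirical law and for the limit. *)
Lemma degree_frac_cvg k : degree_frac n k.+1 @[n --> \oo] --> pmf D k.+1%:R.
Proof.
have [x hx cx] := @cdf_continuity_dense _ _ _ _ D k%:R k.+1%:R ltac:(by rewrite ltr_nat).
have [y hy cy] := @cdf_continuity_dense _ _ _ _ D k.+1%:R k.+2%:R ltac:(by rewrite ltr_nat).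
have fin := cdf_fin_num D.
have xy : x <= y by lra.
have pE : pmf D k.+1%:R = fine (cdf D y) - fine (cdf D x).
  rewrite (cdfB D xy) fineD ?fin_num_measure // addrAC subrr add0r.
  rewrite /pmf -[P _]/(nu [set k.+1%:R]); congr fine.
  apply/eqP; rewrite eq_le; apply/andP; split.
    apply: le_measure; rewrite ?inE // => z /= ->; rewrite in_itv /=; lra.
  have sub : `]x, y]%classic `<=` `]k%:R, k.+1%:R[%classic `|` ([set k.+1%:R : R] `|` `]k.+1%:R, k.+2%:R[%classic).
    move=> z /=; rewrite !in_itv /= => hz.
    have [zk|zk|->] := ltgtP z k.+1%:R; [left|right; right|right; left] => //; lra.
  apply: le_trans (le_measure nu _ _ sub) _; rewrite ?inE //.
    by apply: measurableU => //; apply: measurableU.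
  apply: le_trans (measureU2 _ _ _) _ => //; first by apply: measurableU.
  rewrite [X in (X + _ <= _)%E](_ : _ = 0%E); last exact: distribution_gap.
  rewrite add0e; apply: le_trans (measureU2 _ _ _) _ => //.
  by rewrite [X in (_ + X <= _)%E](_ : _ = 0%E) ?adde0 //; exact: distribution_gap.
have fc z : {for z, continuous (cdf D)} -> degree_cdf (d n) z @[n --> \oo] --> fine (cdf D z).
  move=> cz; apply: (@fine_cvg _ _ _ _ (fun n => (degree_cdf (d n) z)%:E)).
  by rewrite fineK //; exact: degree_cvg.
rewrite pE; apply: cvg_trans (cvgB (fc _ cy) (fc _ cx)).
apply: near_eq_cvg; near=> n.
rewrite -(@degree_cdf_jump n k x y) //; lra.
Unshelve. all: by end_near. Qed.

Let U : set T := \bigcup_k (D @^-1` [set k.+1%:R]).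

Let mU : measurable U.
Proof. by apply: bigcup_measurable => k _; exact: measurable_funPTI. Qed.

(** Off [U], the variable is either below 1 or strictly between consecutive integers, and both
    events are null. *)
Let P_notU : P (~` U) = 0%E.
Proof.
pose N1 := ~` [set w | 1 <= D w].
pose N2 := \bigcup_k (D @^-1` `]k%:R, k.+1%:R[).
have mge : measurable [set w | 1 <= D w].
  rewrite (_ : [set w | 1 <= D w] = D @^-1` `[1, +oo[); first exact: measurable_funPTI.
  by apply/seteqP; split=> w /=; rewrite in_itv /= andbT.
have m1 : measurable N1 by apply: measurableC.
have m2 : measurable N2 by apply: bigcup_measurable => k _; exact: measurable_funPTI.
have sub : ~` U `<=` N1 `|` N2.
  move=> w /= nU; have [D1|] := pselect (1 <= D w); last by left.
  right; exists (Num.truncn (D w)) => //=; rewrite in_itv /= truncnS_gt andbT.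
  have tD : (Num.truncn (D w))%:R <= D w by rewrite truncn_le; lra.
  rewrite lt_neqAle tD andbT; apply/eqP => te; apply: nU.
  have t0 : (0 < Num.truncn (D w))%N by rewrite -(ltr_nat R) te; lra.
  by exists (Num.truncn (D w)).-1 => //=; rewrite prednK.
apply: subset_measure0 sub _ => //; [exact: measurableC | exact: measurableU |].
have z1 : P N1 = 0%E by rewrite /N1 probability_setC // D_ge1 subee.
have z2 : P N2 = 0%E.
  apply/negligibleP => //; apply: negligible_bigcup => k.
  by apply/negligibleP; [exact: measurable_funPTI | exact: distribution_gap].
apply/negligibleP; first exact: measurableU.
by apply: negligibleU; apply/negligibleP.
Qed.

Lemma sum_pmf_degree : (\sum_(k <oo) (pmf D k.+1%:R)%:E = 1)%E.
Proof.
have PU : P U = 1%E.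
  by rewrite -[U]setCK probability_setC ?P_notU ?sube0 //; exact: measurableC.
rewrite -PU /U measure_bigcup //.
- rewrite [RHS](@eq_eseriesl _ _ xpredT); last by move=> k; rewrite in_setT.
  apply: eq_eseriesr => k _.
  by rewrite /pmf fineK // fin_num_measure //; exact: measurable_funPTI.
- by move=> i j _ _ [w [/= -> /eqP]]; rewrite eqr_nat eqSS => /eqP.
Qed.

Lemma expectation_degree : ('E_P[D] = \sum_(k <oo) (k.+1%:R * pmf D k.+1%:R)%:E)%E.
Proof.
rewrite unlock integralE.
have mD : measurable_fun setT (EFin \o D) by apply/measurable_EFinP.
have -> : (\int[P]_x ((EFin \o D)^\- x) = 0)%E.
  rewrite (ge0_negligible_integral (N := ~` U)) //; [|exact: measurableC|exact: measurable_funeneg].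
  rewrite setDE setCK setTI; apply: integral0_eq => w [k _ /= Dw].
  by rewrite funenegE /= Dw max_r // -EFinN lee_fin oppr_le0.
rewrite sube0 (ge0_negligible_integral (N := ~` U)) //; [|exact: measurableC|exact: measurable_funepos].
rewrite setDE setCK setTI ge0_integral_bigcup //; last 2 first.
- by apply: measurable_funTS; apply: measurable_funepos.
- by move=> i j _ _ [w [/= -> /eqP]]; rewrite eqr_nat eqSS => /eqP.
apply: eq_eseriesr => k _.
rewrite (eq_integral (cst k.+1%:R%:E)); last first.
  by move=> w; rewrite inE /= => Dw; rewrite funeposE /= Dw max_l // lee_fin.
rewrite integral_cst; last exact: measurable_funPTI.
by rewrite EFinM /pmf fineK // fin_num_measure //; exact: measurable_funPTI.
Qed.

End degree_limit.

(** * Real series indexed from one *)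

Section series_from_one.
Variable R : realType.
Implicit Types (u v : nat -> R) (l m : R).

(** Convergence and value in one relation: the limit notation in [G_fun] returns a default value for
    a divergent series, so identities are proved here and transferred by [has_sum_lim]. *)
Definition has_sum u l : Prop := (\sum_(1 <= k < N) u k) @[N --> \oo] --> l.

Lemma has_sum_lim u l : has_sum u l -> \big[+%R/0]_(1 <= k <oo) u k = l.
Proof. exact: cvg_lim. Qed.

Lemma has_sum_unique u l m : has_sum u l -> has_sum u m -> l = m.
Proof. exact: cvg_unique. Qed.

Lemma eq_has_sum u v l : (forall k, (1 <= k)%N -> u k = v k) -> has_sum u l -> has_sum v l.
Proof.
move=> uv; rewrite /has_sum (_ : (fun N => \sum_(1 <= k < N) u k) = (fun N => \sum_(1 <= k < N) v k)) //.
by apply/funext => N; apply: eq_big_nat => k /andP[k1 _]; exact: uv.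
Qed.

Lemma has_sumD u v l m : has_sum u l -> has_sum v m -> has_sum (fun k => u k + v k) (l + m).
Proof.
move=> ul vm; rewrite /has_sum; under eq_fun do rewrite big_split /=.
exact: cvgD.
Qed.

Lemma has_sumZ a u l : has_sum u l -> has_sum (fun k => a * u k) (a * l).
Proof.
move=> ul; rewrite /has_sum; under eq_fun do rewrite -mulr_sumr.
by apply: cvgMl_tmp.
Qed.

Lemma ler_has_sum u v l m : has_sum u l -> has_sum v m ->
  (forall k, (1 <= k)%N -> u k <= v k) -> l <= m.
Proof.
move=> ul vm uv; apply: ler_cvg_to ul vm _; near=> N.
by rewrite big_nat_cond [leRHS]big_nat_cond; apply: ler_sum => k /andP[/andP[k1 _] _]; exact: uv.
Unshelve. all: by end_near. Qed.

(** The series of [u + v] has nonnegative terms and partial sums at most [2 m], so it converges;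
    then [v] is subtracted. *)
Lemma dominated_has_sum u v m : has_sum v m ->
  (forall k, (1 <= k)%N -> `|u k| <= v k) -> exists l, has_sum u l.
Proof.
move=> vm uv; have v0 k : (1 <= k)%N -> 0 <= v k by move=> /uv; apply: le_trans.
pose w k := u k + v k.
have w0 k : (1 <= k)%N -> 0 <= w k by move=> /uv; rewrite ler_norml /w; lra.
have mono (t : nat -> R) : (forall k, (1 <= k)%N -> 0 <= t k) ->
    nondecreasing_seq (fun N => \sum_(1 <= k < N) t k).
  move=> t0; apply/nondecreasing_seqP => N; case: N => [|N]; first by rewrite !big_geq.
  by rewrite [leRHS]big_nat_recr //= lerDl t0.
have vle N : \sum_(1 <= k < N) v k <= m.
  have := nondecreasing_cvgn_le (mono _ v0) (cvgP _ vm) N.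
  by rewrite (cvg_lim _ vm).
have cw : cvgn (fun N => \sum_(1 <= k < N) w k).
  apply: nondecreasing_is_cvgn; first exact: mono.
  exists (2 * m) => _ [N _ <-]; apply: (@le_trans _ _ (\sum_(1 <= k < N) 2 * v k)).
    rewrite big_nat_cond [leRHS]big_nat_cond; apply: ler_sum => k /andP[/andP[k1 _] _].
    by rewrite /w; have := uv _ k1; rewrite ler_norml; lra.
  by rewrite -mulr_sumr ler_wpM2l.
exists (limn (fun N => \sum_(1 <= k < N) w k) + -1 * m).
apply: (@eq_has_sum (fun k => w k + -1 * v k)); first by move=> k _; rewrite /w; ring.
by apply: has_sumD => //; apply: has_sumZ.
Qed.

Lemma has_sum_tail u l K : has_sum u l ->
  has_sum (fun k => if (K <= k)%N then u k else 0) (l - \sum_(1 <= k < K) u k).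
Proof.
move=> ul; rewrite /has_sum.
have : (\sum_(1 <= k < N) u k - \sum_(1 <= k < K) u k) @[N --> \oo] --> l - \sum_(1 <= k < K) u k.
  by apply: cvgB => //; exact: cvg_cst.
apply: cvg_trans; apply: near_eq_cvg; near=> N.
have KN : (K <= N)%N by near: N; exact: nbhs_infty_ge.
have [K0|K0] := posnP K.
  by rewrite [X in _ - X]big_geq ?K0 // subr0; apply: eq_bigr => k _.
rewrite [X in X - _](big_cat_nat (n := K)) //= addrAC subrr add0r.
have z : \sum_(1 <= k < K) (if (K <= k)%N then u k else 0) = 0.
  by rewrite big_nat_cond; apply: big1 => k /andP[/andP[_ kK] _]; rewrite leqNgt kK.
rewrite [RHS](big_cat_nat (n := K)) //= z add0r.
by apply: eq_big_nat => k /andP[Kk _]; rewrite Kk.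
Unshelve. all: by end_near. Qed.

Lemma has_sum_series u l : ((\sum_(k <oo) (u k.+1)%:E)%E = l%:E) ->
  (forall k, (1 <= k)%N -> 0 <= u k) -> has_sum u l.
Proof.
move=> ul u0; rewrite /has_sum -cvg_shiftS /=.
have : (\sum_(0 <= k < N) (u k.+1)%:E)%E @[N --> \oo] --> l%:E.
  rewrite -ul; apply: is_cvg_ereal_nneg_natsum_cond => k _ _.
  by rewrite lee_fin u0.
under eq_fun do rewrite sumEFin.
move=> /fine_cvg; apply: cvg_trans; apply: near_eq_cvg; near=> N => /=.
by rewrite big_add1.
Unshelve. all: by end_near. Qed.

End series_from_one.

(** * Uniform convergence of degree averages *)

Section degree_average.
Variable R : realType.
Variable d : forall n : nat, 'I_n -> nat.
Arguments d : clear implicits.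
Hypothesis d_pos : forall (n : nat) (i : 'I_n), (0 < d n i)%N.
Context (disp : measure_display) (T : measurableType disp).
Variables (P : probability T R) (D : {RV P >-> R}).
Hypothesis D_ge1 : P [set w | 1 <= D w] = 1%E.
Hypothesis degree_cvg : cvg_in_distribution (fun n => @degree_cdf n (d n) R) D.
Hypothesis mean_cvg : (degree_mean (d n) R)%:E @[n --> \oo] --> 'E_P[D]%E.
Hypothesis mean_fin : ('E_P[D] < +oo)%E.

Let p k : R := pmf D k%:R.
Let mu : R := expected_degree D.
Let q n k : R := degree_frac R d n k.

Lemma expected_degreeE : 'E_P[D]%E = mu%:E.
Proof.
rewrite /mu /expected_degree fineK // ge0_fin_numE //.
rewrite (expectation_degree D_ge1 degree_cvg); apply: nneseries_ge0 => k _ _.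
by rewrite lee_fin mulr_ge0 // pmf_ge0.
Qed.

Lemma has_sum_degree : has_sum (fun k => k%:R * p k) mu.
Proof.
apply: has_sum_series; last by move=> k _; rewrite mulr_ge0 // pmf_ge0.
by rewrite -expected_degreeE (expectation_degree D_ge1 degree_cvg).
Qed.

Lemma has_sum_pmf : has_sum p 1.
Proof.
apply: has_sum_series; last by move=> k _; exact: pmf_ge0.
exact: (sum_pmf_degree D_ge1 degree_cvg).
Qed.

Lemma expected_degree_ge1 : 1 <= mu.
Proof.
apply: ler_has_sum has_sum_pmf has_sum_degree _ => k k1.
by rewrite ler_peMl ?pmf_ge0 // ler1n.
Qed.

Lemma degree_mean_cvg : degree_mean (d n) R @[n --> \oo] --> mu.
Proof. by have := mean_cvg; rewrite expected_degreeE => /fine_cvg. Qed.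

Let q_cvg k : (1 <= k)%N -> q n k @[n --> \oo] --> p k.
Proof. by case: k => // k _; exact: degree_frac_cvg. Qed.

(** Vertices are grouped by degree; positivity of the degrees allows the sum to start at 1. *)
Lemma sum_degree_trunc (g : nat -> R) n K :
  (\sum_(i < n) (if (d n i < K)%N then g (d n i) else 0)) / n%:R =
  \sum_(1 <= k < K) q n k * g k.
Proof.
transitivity ((\sum_(1 <= k < K) \sum_(i < n) (if d n i == k then g k else 0)) / n%:R); last first.
  rewrite mulr_suml; apply: eq_bigr => k _.
  rewrite /q /degree_frac -big_mkcond /= sumr_const mulrAC; congr (_ / _).
  rewrite mulr_natl; congr (_ *+ _); rewrite cardsE.
  by apply: eq_card => i.
congr (_ / _); rewrite exchange_big /=; apply: eq_bigr => i _.
rewrite -big_mkcond /=.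
rewrite (eq_bigl (fun k => k == d n i)); last by move=> k; rewrite eq_sym.
by rewrite big_nat1_eq d_pos.
Qed.

Let err_cvg K : (\sum_(1 <= k < K) k%:R * `|q n k - p k|) @[n --> \oo] --> (0 : R).
Proof.
elim: K => [|K IH]; first by under eq_fun do rewrite big_geq //; exact: cvg_cst.
have [->|K0] := posnP K; first by under eq_fun do rewrite big_geq //; exact: cvg_cst.
under eq_fun do rewrite big_nat_recr //=.
have c1 : (q n K - p K) @[n --> \oo] --> p K - p K.
  by apply: cvgB; [exact: q_cvg | exact: cvg_cst].
have c2 : K%:R * `|q n K - p K| @[n --> \oo] --> K%:R * `|p K - p K|.
  by apply: cvgMl_tmp; exact: cvg_norm c1.
by have := cvgD IH c2; rewrite subrr normr0 mulr0 addr0; exact.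
Qed.

(** Convergence of the law handles degrees below a cutoff, and convergence of the mean makes the
    empirical tail small. The test function enters only through [C], so the threshold on [n] does
    not depend on it; this allows tangent points that vary with [n]. *)
Lemma uniform_degree_average (eps : R) : 0 < eps -> \forall n \near \oo,
  forall (h : nat -> R) (C l : R), 0 <= C ->
    (forall k, (1 <= k)%N -> `|h k| <= C * k%:R) -> has_sum (fun k => p k * h k) l ->
    `|(\sum_(i < n) h (d n i)) / n%:R - l| <= C * eps.
Proof.
(* One share for the tail of the limit, one for the small degrees and three for the empirical tail
   [A]. *)
move=> eps0; pose e := eps / 5.
have e0 : 0 < e by rewrite divr_gt0.
have /cvgrPdist_lt /(_ e e0) [K _ /(_ K (leqnn K)) /= hK] := has_sum_degree.
set S := \sum_(1 <= k < K) k%:R * p k in hK.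
have tail : has_sum (fun k => if (K <= k)%N then k%:R * p k else 0) (mu - S).
  exact: has_sum_tail has_sum_degree.
have /cvgrPdist_lt /(_ e e0) near1 := @err_cvg K.
have /cvgrPdist_lt /(_ e e0) near2 := degree_mean_cvg.
near=> n.
have h1 : \sum_(1 <= k < K) k%:R * `|q n k - p k| < e.
  have : `|0 - \sum_(1 <= k < K) k%:R * `|q n k - p k| | < e by near: n.
  rewrite sub0r normrN => /(le_lt_trans (ler_norm _)); exact.
have h2 : `|mu - degree_mean (d n) R| < e by near: n.
have n0 : (0 < n)%N by near: n; exists 1%N.
move=> h C l C0 hC hl.
have Ctail : `|l - \sum_(1 <= k < K) p k * h k| <= C * (mu - S).
  have t1 := has_sum_tail (K := K) hl; have t2 := has_sumZ (a := C) tail; have t3 := has_sumZ (a := - C) tail.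
  have pt k : (1 <= k)%N -> `|if (K <= k)%N then p k * h k else 0| <=
      C * (if (K <= k)%N then k%:R * p k else 0).
    move=> k1; case: ifP => _; last by rewrite normr0 mulr0.
    rewrite normrM ger0_norm ?pmf_ge0 // mulrC mulrA.
    by apply: ler_wpM2r; [exact: pmf_ge0 | exact: hC].
  rewrite ler_norml; apply/andP; split.
    rewrite -mulNr; apply: ler_has_sum t3 t1 _ => k /pt.
    by rewrite ler_norml mulNr => /andP[].
  by apply: ler_has_sum t1 t2 _ => k /pt; rewrite ler_norml => /andP[].
have split_sum (g : nat -> R) : (\sum_(i < n) g (d n i)) / n%:R =
    \sum_(1 <= k < K) q n k * g k +
    (\sum_(i < n) (if (d n i < K)%N then 0 else g (d n i))) / n%:R.
  rewrite -sum_degree_trunc -mulrDl -big_split /=; congr (_ / _).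
  by apply: eq_bigr => i _; case: ifP; rewrite ?addr0 ?add0r.
have dm : degree_mean (d n) R = \sum_(1 <= k < K) q n k * k%:R +
    (\sum_(i < n) (if (d n i < K)%N then 0 else (d n i)%:R)) / n%:R.
  by rewrite -split_sum /degree_mean /total_degree natr_sum.
set A := (\sum_(i < n) (if (d n i < K)%N then 0 else (d n i)%:R)) / n%:R in dm.
have big_part : `|(\sum_(i < n) (if (d n i < K)%N then 0 else h (d n i))) / n%:R| <= C * A.
  rewrite normrM [`|_^-1|]ger0_norm ?invr_ge0 // /A mulrA ler_pM2r ?invr_gt0 ?ltr0n //.
  apply: le_trans (ler_norm_sum _ _ _) _; rewrite mulr_sumr; apply: ler_sum => i _.
  by case: ifP => _; rewrite ?normr0 ?mulr0 // hC.
have small_part : `|\sum_(1 <= k < K) q n k * h k - \sum_(1 <= k < K) p k * h k| <= C * e.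
  apply: (@le_trans _ _ (C * \sum_(1 <= k < K) k%:R * `|q n k - p k|)); last first.
    by rewrite ler_wpM2l // ltW.
  rewrite -sumrB; apply: le_trans (ler_norm_sum _ _ _) _; rewrite mulr_sumr.
  rewrite big_nat_cond [leRHS]big_nat_cond; apply: ler_sum => k /andP[/andP[k1 _] _].
  by rewrite -mulrBl normrM mulrC mulrA ler_wpM2r // hC.
(* The empirical tail is the mean minus the truncated mean, and both are close to their limits. *)
have A_le : A <= 3 * e.
  have : `|\sum_(1 <= k < K) q n k * k%:R - S| <= \sum_(1 <= k < K) k%:R * `|q n k - p k|.
    rewrite /S -sumrB; apply: le_trans (ler_norm_sum _ _ _) _; apply: ler_sum => k _.
    by rewrite [q n k * _]mulrC -mulrBr normrM ger0_norm.
  move: hK h2 h1; rewrite dm !ltr_norml ler_norml; lra.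
rewrite split_sum.
have eE : eps = 5 * e by rewrite /e; field.
have CA : C * A <= C * (3 * e) by rewrite ler_wpM2l.
have CK : C * (mu - S) <= C * e by rewrite ler_wpM2l // ltW // (le_lt_trans (ler_norm _)).
move: Ctail big_part small_part; rewrite eE !ler_norml; lra.
Unshelve. all: by end_near. Qed.

End degree_average.

(** * The Gibbs variational principle and the limit *)

Section gibbs.
Variable R : realType.
Implicit Types s x y : R.

Lemma ln_le_subr1 x : 0 < x -> ln x <= x - 1.
Proof. by move=> x0; rewrite -{1}(subrK 1 x) addrC le_ln1Dx //; lra. Qed.

(** From [ln (1/t) <= 1/t - 1], the two terms are at most [1 - s] and [s]. *)
Lemma entropy_itv s : 0 < s < 1 -> 0 <= entropy s <= 1.
Proof.
move=> /andP[s0 s1]; rewrite /entropy.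
have bound (t : R) : 0 < t < 1 -> 0 <= - t * ln t <= 1 - t.
  move=> /andP[t0 t1].
  have l1 : ln t <= 0 by apply: ln_le0; lra.
  have := @ln_le_subr1 t^-1 ltac:(by rewrite invr_gt0).
  rewrite lnV ?posrE // => l2.
  have : t * - ln t <= t * (t^-1 - 1) by rewrite ler_pM2l.
  rewrite mulrBr mulfV ?gt_eqF // mulr1; nra.
by have := @bound s ltac:(lra); have := @bound (1 - s) ltac:(lra); lra.
Qed.

(** Nonnegativity of the entropy relative to the two-point Gibbs law with weights [expR x] and
    [expR y], derived from [ln z <= z - 1]. *)
Lemma gibbs_le s x y : 0 < s < 1 ->
  entropy s + (s * x + (1 - s) * y) <= ln (expR x + expR y).
Proof.
move=> /andP[s0 s1]; set Z := expR x + expR y.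
have [ex ey] := (expR_gt0 x, expR_gt0 y).
have Z0 : 0 < Z by rewrite addr_gt0.
have key (t z : R) : 0 < t -> t * z - t * ln t - t * ln Z <= expR z / Z - t.
  move=> t0; have := @ln_le_subr1 (expR z / (t * Z)) ltac:(by rewrite divr_gt0 ?mulr_gt0 ?expR_gt0).
  rewrite ln_div ?posrE ?mulr_gt0 ?expR_gt0 // lnM ?posrE // expRK => h.
  have := ler_wpM2l (ltW t0) h.
  rewrite (_ : t * (expR z / (t * Z) - 1) = expR z / Z - t); last by field; lra.
  by lra.
have k1 := key s x s0; have k2 := key (1 - s) y ltac:(lra).
have e : expR x / Z + expR y / Z = 1 by rewrite -mulrDl mulfV // gt_eqF.
rewrite /entropy; lra.
Qed.

Lemma gibbs_eq x y (s := expR x / (expR x + expR y)) :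
  0 < s < 1 /\ entropy s + (s * x + (1 - s) * y) = ln (expR x + expR y).
Proof.
have [ex ey] := (expR_gt0 x, expR_gt0 y); have Z0 := addr_gt0 ex ey.
have s1E : 1 - s = expR y / (expR x + expR y) by rewrite /s; field; lra.
have s0 : 0 < s by rewrite divr_gt0.
have s1 : 0 < 1 - s by rewrite s1E divr_gt0.
split; first lra.
have l1 : ln s = x - ln (expR x + expR y) by rewrite /s ln_div ?posrE // expRK.
have l2 : ln (1 - s) = y - ln (expR x + expR y) by rewrite s1E ln_div ?posrE // expRK.
by rewrite /entropy l1 l2; ring.
Qed.

End gibbs.

(** * The supremum of G as a supremum over tangent points *)

Section limit_functional.
Variable R : realType.
Variable d : forall n : nat, 'I_n -> nat.
Arguments d : clear implicits.
Context (disp : measure_display) (T : measurableType disp).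
Variables (P : probability T R) (D : {RV P >-> R}).
Hypothesis D_ge1 : P [set w | 1 <= D w] = 1%E.
Hypothesis degree_cvg : cvg_in_distribution (fun n => @degree_cdf n (d n) R) D.
Hypothesis mean_cvg : (degree_mean (d n) R)%:E @[n --> \oo] --> 'E_P[D]%E.
Hypothesis mean_fin : ('E_P[D] < +oo)%E.
Variables (beta B : R).
Hypothesis beta_ge0 : 0 <= beta.

Let p k : R := pmf D k%:R.
Let mu : R := expected_degree D.
Let C : R := `|B| + 2 * beta + 1.

(** The upper bound uses [ln 2 <= 1], the lower one drops the plus term. Linear growth in [k] is
    what [uniform_degree_average] requires. *)
Lemma tilted_free_energy_bound (theta : R) k : `|theta| <= 2 * beta -> (1 <= k)%N ->
  `|tilted_free_energy B theta k| <= (`|B| + 2 * beta + 1) * k%:R.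
Proof.
move=> th k1; rewrite /tilted_free_energy.
have k1R : 1 <= k%:R :> R by rewrite ler1n.
set x := B + _; have xb : x <= `|B| + 2 * beta * k%:R.
  rewrite /x lerD ?ler_norm // ler_wpM2r //; apply: le_trans th; exact: ler_norm.
have b0 : - B <= `|B| by rewrite -normrN ler_norm.
have n0 := normr_ge0 B.
have bk : 0 <= 2 * beta * k%:R by rewrite !mulr_ge0.
have nk : `|B| <= `|B| * k%:R by rewrite ler_peMr.
have e1 : expR x <= expR (`|B| + 2 * beta * k%:R) by rewrite ler_expR.
have e2 : expR (- B) <= expR (`|B| + 2 * beta * k%:R) by rewrite ler_expR; lra.
have e0 := expR_gt0 (`|B| + 2 * beta * k%:R).
have [ex ey] := (expR_gt0 x, expR_gt0 (- B)).
have up : ln (expR x + expR (- B)) <= 1 + (`|B| + 2 * beta * k%:R).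
  apply: (@le_trans _ _ (ln ((1 + 1) * expR (`|B| + 2 * beta * k%:R)))).
    rewrite ler_ln ?posrE ?mulr_gt0 ?addr_gt0 //; lra.
  rewrite lnM ?posrE ?addr_gt0 // expRK lerD2r; apply: le_ln1Dx; lra.
have lo : - B <= ln (expR x + expR (- B)).
  by rewrite -[leLHS]expRK ler_ln ?posrE ?addr_gt0 //; lra.
have b1 : - `|B| <= - B by rewrite lerN2 ler_norm.
rewrite ler_norml mulrDl mulrDl mul1r; apply/andP; split; lra.
Qed.

(** Limit per vertex of the decoupled bound at the tangent point [a], apart from the term
    [beta * mu / 2]. *)
Definition tangent_functional (a : R) : R :=
  mu * (F_fun beta a - a * F_slope beta a)
  + \big[+%R/0]_(1 <= k <oo) (p k * tilted_free_energy B (F_slope beta a) k).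

Let degree_sum := has_sum_degree D_ge1 degree_cvg mean_fin.
Let pmf_sum := has_sum_pmf D_ge1 degree_cvg.
Let mu_ge1 : 1 <= mu := expected_degree_ge1 D_ge1 degree_cvg mean_fin.
Let p_ge0 k : 0 <= p k. Proof. exact: pmf_ge0. Qed.

Lemma has_sum_tilted (a : R) : 0 <= a <= 1 ->
  has_sum (fun k => p k * tilted_free_energy B (F_slope beta a) k)
   (\big[+%R/0]_(1 <= k <oo) (p k * tilted_free_energy B (F_slope beta a) k)).
Proof.
move=> a01.
have [l hl] : exists l, has_sum (fun k => p k * tilted_free_energy B (F_slope beta a) k) l.
  apply: (@dominated_has_sum _ _ (fun k => C * (k%:R * p k)) (C * mu)).
    by apply: has_sumZ; exact: degree_sum.
  move=> k k1; rewrite normrM ger0_norm // mulrC mulrA ler_wpM2r //.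
  by apply: tilted_free_energy_bound => //; exact: F_slope_bound.
by rewrite (has_sum_lim hl).
Qed.

Let has_sum_G (s : nat -> R) : (forall k, (1 <= k)%N -> 0 < s k < 1) ->
  exists e h m, [/\ has_sum (fun k => p k * entropy (s k)) e,
    has_sum (fun k => s k * p k) h, has_sum (fun k => k%:R * p k * s k) m,
    0 <= m <= mu & G_fun D beta B s = e + B * (2 * h - 1) + mu * F_fun beta (m / mu)].
Proof.
move=> s01.
have [e he] : exists l, has_sum (fun k => p k * entropy (s k)) l.
  apply: (dominated_has_sum pmf_sum) => k k1; have /andP[e0 e1] := entropy_itv (s01 k k1).
  by rewrite ger0_norm ?mulr_ge0 // ler_piMr.
have [h hh] : exists l, has_sum (fun k => s k * p k) l.
  apply: (dominated_has_sum pmf_sum) => k k1; have /andP[s0 s1] := s01 k k1.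
  by rewrite ger0_norm ?mulr_ge0 ?(ltW s0) // ler_piMl // ltW.
have ms k : (1 <= k)%N -> 0 <= k%:R * p k * s k <= k%:R * p k.
  move=> k1; have /andP[s0 s1] := s01 k k1.
  by rewrite !mulr_ge0 ?(ltW s0) //= ler_piMr ?mulr_ge0 // ltW.
have [m hm] : exists l, has_sum (fun k => k%:R * p k * s k) l.
  by apply: (dominated_has_sum degree_sum) => k /ms /andP[m0 m1]; rewrite ger0_norm.
exists e, h, m; split => //.
  apply/andP; split; last by apply: ler_has_sum hm degree_sum _ => k /ms /andP[].
  have z := has_sumZ (a := 0) pmf_sum; rewrite mul0r in z.
  by apply: ler_has_sum z hm _ => k /ms /andP[m0 _]; rewrite mul0r.
by rewrite /G_fun (has_sum_lim he) (has_sum_lim hh) (has_sum_lim hm).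
Qed.

(** Entropy, field and linearised interaction are collected into one series whose terms suit the
    Gibbs inequality; the constant [- B] uses total mass 1. *)
Let has_sum_tangent (s : nat -> R) (theta e h m : R) :
  has_sum (fun k => p k * entropy (s k)) e ->
  has_sum (fun k => s k * p k) h -> has_sum (fun k => k%:R * p k * s k) m ->
  has_sum (fun k => p k * (entropy (s k) + (s k * (B + theta * k%:R) + (1 - s k) * - B)))
    (e + B * (2 * h - 1) + theta * m).
Proof.
move=> he hh hm.
have H := has_sumD (has_sumD he (has_sumD (has_sumZ (a := 2 * B) hh) (has_sumZ (a := - B) pmf_sum)))
  (has_sumZ (a := theta) hm).
rewrite (_ : e + B * (2 * h - 1) + theta * m = e + (2 * B * h + - B * 1) + theta * m); last by ring.
by apply: eq_has_sum H => k _; rewrite /p /=; ring.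
Qed.

(** At [a = m / mu] the tangent is exact, and the Gibbs inequality applies degree by degree. *)
Lemma G_fun_le (s : nat -> R) : (forall k, (1 <= k)%N -> 0 < s k < 1) ->
  exists2 a : R, 0 <= a <= 1 & G_fun D beta B s <= tangent_functional a.
Proof.
move=> s01; have [e [h [m [he hh hm /andP[m0 m1] ->]]]] := has_sum_G s01.
have mu0 : 0 < mu by exact: lt_le_trans mu_ge1.
have a01 : 0 <= m / mu <= 1 by rewrite divr_ge0 ?(ltW mu0) //= ler_pdivrMr // mul1r.
exists (m / mu) => //; rewrite /tangent_functional.
set th := F_slope beta (m / mu).
have := ler_has_sum (has_sum_tangent (theta := th) he hh hm) (has_sum_tilted a01).
move=> /(_ (fun k k1 => ler_wpM2l (p_ge0 k) (gibbs_le _ _ (s01 k k1)))).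
have : mu * (m / mu * th) = th * m by field; lra.
rewrite -/th; lra.
Qed.

(** Taking for [s k] the Gibbs probability of a plus spin gives equality for each degree; then
    [F_fun] lies above its tangent at [a]. *)
Lemma G_fun_ge (a : R) : 0 <= a <= 1 ->
  exists2 s : nat -> R, (forall k, (1 <= k)%N -> 0 < s k < 1) &
    tangent_functional a <= G_fun D beta B s.
Proof.
move=> a01; set th := F_slope beta a.
pose s (k : nat) := expR (B + th * k%:R) / (expR (B + th * k%:R) + expR (- B)).
have s01 k : (1 <= k)%N -> 0 < s k < 1 by move=> _; case: (gibbs_eq (B + th * k%:R) (- B)).
exists s => //; have [e [h [m [he hh hm /andP[m0 m1] ->]]]] := has_sum_G s01.
have mu0 : 0 < mu by exact: lt_le_trans mu_ge1.
have t01 : 0 <= m / mu <= 1 by rewrite divr_ge0 ?(ltW mu0) //= ler_pdivrMr // mul1r.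
rewrite /tangent_functional -/th.
have E : e + B * (2 * h - 1) + th * m =
    \big[+%R/0]_(1 <= k <oo) (p k * tilted_free_energy B th k).
  apply: has_sum_unique (has_sum_tilted a01).
  apply: eq_has_sum (has_sum_tangent (theta := th) he hh hm) => k _; congr (_ * _).
  by case: (gibbs_eq (B + th * k%:R) (- B)).
rewrite -E; have := F_fun_tangent beta_ge0 a01 t01; rewrite -/th.
rewrite -(ler_pM2l mu0) (_ : mu * (F_fun beta a + th * (m / mu - a)) =
  mu * (F_fun beta a - a * th) + th * m); last by field; lra.
lra.
Qed.

(** The intercept is bounded by evaluating the tangent at [a] in 0 and the tangent at 0 in [a], as
    [F_fun] vanishes at 0. *)
Lemma tangent_functional_bounded (a : R) : 0 <= a <= 1 ->
  `|F_fun beta a - a * F_slope beta a| <= 4 * beta /\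
  tangent_functional a <= mu * (4 * beta) + C * mu.
Proof.
move=> a01.
have z01 : 0 <= (0 : R) <= 1 by lra.
have t1 := F_fun_tangent beta_ge0 a01 z01; have t2 := F_fun_tangent beta_ge0 z01 a01.
have s1 := F_slope_bound beta_ge0 a01; have s2 := F_slope_bound beta_ge0 z01.
rewrite F_fun0 // in t1 t2; rewrite !ler_norml in s1 s2.
have b1 : `|F_fun beta a - a * F_slope beta a| <= 4 * beta.
  rewrite ler_norml; apply/andP; split; nra.
split => //; rewrite /tangent_functional; apply: lerD.
  rewrite ler_wpM2l //; first by apply: le_trans mu_ge1.
  by apply: le_trans b1; exact: ler_norm.
apply: (ler_has_sum (has_sum_tilted a01) (has_sumZ (a := C) degree_sum)) => k k1.
rewrite -/p [leRHS]mulrA [leRHS]mulrC ler_wpM2l //.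
apply: le_trans (ler_norm _) _.
by apply: tilted_free_energy_bound => //; exact: F_slope_bound.
Qed.

Definition tangent_values : set R := [set tangent_functional a | a in [set a : R | 0 <= a <= 1]].

Lemma tangent_values_has_sup : has_sup tangent_values.
Proof.
have z01 : 0 <= (0 : R) <= 1 by lra.
split; first by exists (tangent_functional 0); exists 0.
by exists (mu * (4 * beta) + C * mu) => _ [a /= a01 <-]; case: (tangent_functional_bounded a01).
Qed.

Lemma annealed_limitE : annealed_limit D beta B = beta * mu / 2 + sup tangent_values.
Proof.
rewrite /annealed_limit -/mu; congr (_ + _).
set S := [set G_fun D beta B s | s in _].
have ubS : ubound S (sup tangent_values).
  move=> _ [s /= s01 <-]; have [a a01 h] := G_fun_le s01; apply: le_trans h _.
  by apply: ub_le_sup; [case: tangent_values_has_sup | exists a].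
apply/eqP; rewrite eq_le; apply/andP; split; apply: ge_sup => //.
- have [s s01 _] := @G_fun_ge 0 ltac:(lra).
  by exists (G_fun D beta B s), s.
- by case: tangent_values_has_sup.
- move=> _ [a /= a01 <-]; have [s s01 h] := G_fun_ge a01; apply: le_trans h _.
  by apply: ub_le_sup; [exists (sup tangent_values) | exists s].
Qed.

End limit_functional.

(** * Convergence of the annealed pressure *)

Theorem theorem1p2 (R : realType)
    (d : forall n : nat, 'I_n -> nat)
    (d_pos : forall (n : nat) (i : 'I_n), (0 < d n i)%N)
    (d_even : forall n : nat, ~~ odd (total_degree (d n)))
    (disp : measure_display) (T : measurableType disp)
    (P : probability T R) (D : {RV P >-> R})
    (D_ge1 : P [set w | 1 <= D w] = 1%E)
    (degree_cvg : cvg_in_distribution (fun n => @degree_cdf n (d n) R) D)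
    (mean_cvg : (degree_mean (d n) R)%:E @[n --> \oo] --> 'E_P[D]%E)
    (mean_fin : ('E_P[D] < +oo)%E)
    (max_small : (fun n => (max_degree (d n))%:R : R^o)
                   =o_\oo (fun n => n%:R / ln n%:R : R^o))
    (beta B : R) (beta_ge0 : 0 <= beta) :
  annealed_pressure (d n) beta B @[n --> \oo] --> annealed_limit D beta B.
Proof.
rewrite (annealed_limitE D_ge1 degree_cvg mean_fin B beta_ge0).
set mu := expected_degree D; set A := tangent_values D beta B.
have supA : has_sup A := tangent_values_has_sup D_ge1 degree_cvg mean_fin B beta_ge0.
have mu1 : 1 <= mu := expected_degree_ge1 D_ge1 degree_cvg mean_fin.
pose c0 : R := beta * (1 - expR (- 2 * beta)) / expR (- 2 * beta) + 2 * beta.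
pose c1 : R := `|B| + 2 * beta + 1.
(* The part [beta / 2 + 4 * beta + c1] comes from [close]; the 4 leaves room for [c0 / n], the
   logarithm and the approximation of the supremum. *)
pose M : R := beta / 2 + 4 + 4 * beta + c1.
have c1_ge0 : 0 <= c1 by rewrite !addr_ge0 // mulr_ge0.
have M0 : 0 < M by rewrite /M; lra.
apply/cvgrPdist_le => e e0; pose eps : R := e / M.
have eps0 : 0 < eps by rewrite divr_gt0.
(* With [ln x <= delta x - 1 - ln delta] and [x <= (mu + 2) n], the logarithm is at most [eps n]
   plus a constant. *)
pose delta : R := eps / (mu + 2).
have delta0 : 0 < delta by rewrite divr_gt0 //; lra.
have meanc := degree_mean_cvg D_ge1 degree_cvg mean_cvg mean_fin.
have near_avg := uniform_degree_average d_pos D_ge1 degree_cvg mean_cvg mean_fin eps0.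
have /cvgrPdist_le /(_ eps eps0) near_mean := meanc.
have /cvgrPdist_le /(_ 1 ltr01) near_mean1 := meanc.
near=> n.
have avg : forall (h : nat -> R) (C l : R), 0 <= C ->
    (forall k, (1 <= k)%N -> `|h k| <= C * k%:R) ->
    has_sum (fun k => pmf D k%:R * h k) l ->
    `|(\sum_(i < n) h (d n i)) / n%:R - l| <= C * eps by near: n.
have mean_eps : `|mu - degree_mean (d n) R| <= eps by near: n.
have mean_1 : `|mu - degree_mean (d n) R| <= 1 by near: n.
have n_gt0 : (0 < n)%N by near: n; exists 1%N.
have c0n : `|c0| / eps <= n%:R by near: n; exact: nbhs_infty_ger.
have dn : `|ln delta| / eps <= n%:R by near: n; exact: nbhs_infty_ger.
have n0 : (0 : R) < n%:R by rewrite ltr0n.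
have n1 : (1 : R) <= n%:R by rewrite ler1n.
rewrite ler_pdivrMr // mulrC -ler_pdivrMr // in c0n.
rewrite ler_pdivrMr // mulrC -ler_pdivrMr // in dn.
pose k := (total_degree (d n))./2.
have dk : total_degree (d n) = k.*2 by rewrite -[LHS]odd_double_half (negPf (d_even n)).
have k_gt0 : (0 < k)%N.
  rewrite -double_gt0 -dk /total_degree (bigD1 (Ordinal n_gt0)) //=.
  by rewrite addn_gt0 d_pos.
set mean := degree_mean (d n) R in mean_eps mean_1.
have meanE : k.*2%:R = mean * n%:R by rewrite /mean /degree_mean dk mulfVK // gt_eqF.
have kE : k%:R = mean * n%:R / 2 by rewrite -meanE -muln2 natrM mulfK.
have log_small : ln (k.*2.+1%:R) / n%:R <= 2 * eps.
  have l0 : (0 : R) < k.*2.+1%:R by rewrite ltr0n.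
  have := ln_le_subr1 (mulr_gt0 delta0 l0); rewrite lnM ?posrE // -natr1 meanE => h.
  have h2 : ln (mean * n%:R + 1) <= delta * (mean * n%:R + 1) + `|ln delta|.
    by have := ler_norm (- ln delta); rewrite normrN; lra.
  have h3 : mean * n%:R + 1 <= (mu + 2) * n%:R.
    rewrite -subr_ge0 (_ : _ - _ = (mu - mean + 1) * n%:R + (n%:R - 1)); last by ring.
    move: mean_1; rewrite ler_norml => /andP[m1 m2].
    by rewrite addr_ge0 ?mulr_ge0 //; lra.
  have h4 : delta * (mean * n%:R + 1) <= eps * n%:R.
    have -> : eps = delta * (mu + 2) by rewrite /delta divfK // gt_eqF //; lra.
    by rewrite -mulrA ler_pM2l.
  rewrite ler_pdivrMr //; move: dn; rewrite ler_pdivrMr // => dn'; lra.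
have c0_small : c0 / n%:R <= eps.
  by apply: le_trans c0n; rewrite ler_pM2r ?invr_gt0 // ler_norm.
pose X a := F_fun beta a - a * F_slope beta a.
pose H a := (\sum_(i < n) tilted_free_energy B (F_slope beta a) (d n i)) / n%:R.
(* The bound is uniform in [a], as needed at the point [a0] below, which depends on [n]. *)
have close (a : R) : 0 <= a <= 1 ->
    `|beta * mean / 2 + (mean * X a + H a) - (beta * mu / 2 + tangent_functional D beta B a)|
      <= (beta / 2 + 4 * beta + c1) * eps.
  move=> a01; have [x4 _] := tangent_functional_bounded D_ge1 degree_cvg mean_fin B beta_ge0 a01.
  have hb j : (1 <= j)%N -> `|tilted_free_energy B (F_slope beta a) j| <= c1 * j%:R.
    by move=> j1; apply: tilted_free_energy_bound => //; exact: F_slope_bound.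
  have := avg _ _ _ c1_ge0 hb (has_sum_tilted (B := B) D_ge1 degree_cvg mean_fin beta_ge0 a01).
  rewrite -/(H a) /tangent_functional -/mu -/(X a).
  set L := \big[_/_]_(1 <= j <oo) _ => HL.
  rewrite (_ : _ - _ = (mean - mu) * (beta / 2 + X a) + (H a - L)); last by field.
  apply: le_trans (ler_normD _ _) _; rewrite [leRHS]mulrDl; apply: lerD => //.
  rewrite normrM mulrC; apply: ler_pM => //; last by rewrite distrC.
  apply: le_trans (ler_normD _ _) _; apply: lerD => //.
  by rewrite ger0_norm // divr_ge0.
have lower (a : R) : 0 <= a <= 1 ->
    beta * mean / 2 - c0 / n%:R + (mean * X a + H a) <= annealed_pressure (d n) beta B.
  move=> a01; rewrite /annealed_pressure ler_pdivlMr //.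
  apply: le_trans (ln_CM_expectation_ge dk B beta_ge0 k_gt0 a01).
  rewrite le_eqVlt; apply/orP; left; apply/eqP.
  by rewrite -/c0 -/(X a) meanE kE /H; field; rewrite gt_eqF.
have [a0 a01 upper] : exists2 a : R, 0 <= a <= 1 & annealed_pressure (d n) beta B <=
    beta * mean / 2 + c0 / n%:R + ln (k.*2.+1%:R) / n%:R + (mean * X a + H a).
  have [a a01 h] := ln_CM_expectation_le dk B beta_ge0 k_gt0.
  exists a => //; rewrite /annealed_pressure ler_pdivrMr //; apply: le_trans h _.
  rewrite le_eqVlt; apply/orP; left; apply/eqP.
  rewrite -/c0 -/(X a) kE /H; move: (ln _) => lk; rewrite meanE.
  by field; rewrite gt_eqF.
have eE : e = M * eps by rewrite /eps mulrC mulfVK // gt_eqF.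
rewrite eE ler_norml; apply/andP; split.
  have : tangent_functional D beta B a0 <= sup A.
    by apply: ub_le_sup; [case: supA | exists a0].
  by have := close a0 a01; rewrite ler_norml /M; lra.
(* For the lower bound, a point attaining the supremum up to [eps] suffices. *)
have [_ [a /= a01' <-]] := sup_adherent eps0 supA.
have := close a a01'; have := lower a a01'; rewrite ler_norml /M; lra.
Unshelve. all: by end_near. Qed.
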